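(* Let $n\ge 2$ be an integer. There is a constant $C_n$, depending only on $n$, such that for every integer $N\ge 2$ there exists a set $\mathcal P\subset[0,1]^n$ of cardinality $N$ whose discrepancy function $\mathcal D_N$ satisfies \[ \lVert \mathcal D_N\rVert_{\exp\left(L^{\frac{2}{n+1}}\right)} \le C_n (\log N)^{\frac{n-1}{2}} . \]
   Context: For a finite set $\mathcal P\subset[0,1]^n$ of $N$ points, the discrepancy function is $\mathcal D_N(X)=\sharp\big(\mathcal P\cap[0,X]\big)-N\,|[0,X]|$ for $X=(x_1,\dots,x_n)\in[0,1]^n$, where $[0,X]=\prod_{j=1}^n[0,x_j]$ and $|[0,X]|=x_1\cdots x_n$ is its volume. For an increasing convex function $\psi:\mathbb R^+\to\mathbb R^+$ with $\psi(0)=0$, the Orlicz norm is $\|f\|_{L^\psi}=\inf\{K>0:\int_{[0,1]^n}\psi(|f(x)|/K)\,dx\le 1\}$. For $\alpha>0$, $\exp(L^\alpha)$ denotes the Orlicz space associated with a function $\psi$ of this type that equals $e^{x^\alpha}-1$ for all sufficiently large $x$ (different such choices give equivalent norms). *)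

(* Defs.v *)
From HB Require Import structures.
From mathcomp Require Import all_boot all_order all_algebra finmap.
From mathcomp Require Import all_classical all_reals all_analysis.

Set Implicit Arguments.
Unset Strict Implicit.
Unset Printing Implicit Defensive.

Import Order.TTheory GRing.Theory Num.Theory.
Import numFieldNormedType.Exports.

Local Open Scope classical_set_scope.
Local Open Scope ring_scope.

(* measurableTypeR R is R with its Borel sigma-algebra in the presentation used
   by lebesgue_measure, so that the canonical sigma-algebra on n-tuples is the
   Borel sigma-algebra of R^n. *)
Notation euclid R n := (n.-tuple (measurableTypeR R)).

Lemma product_sigma_finite d1 d2 (T1 : measurableType d1)
    (T2 : measurableType d2) (R : realType)
    (m1 : {sigma_finite_measure set T1 -> \bar R})
    (m2 : {sigma_finite_measure set T2 -> \bar R}) :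
  sigma_finite setT (m1 \x m2)%E.
Proof.
have /sigma_finiteP[F [TF ndF Foo]] := sigma_finiteT m1.
have /sigma_finiteP[G [TG ndG Goo]] := sigma_finiteT m2.
exists (fun n => F n `*` G n).
  rewrite -setXTT TF TG predeqE => -[x y]; split.
    move=> [/= [n _ Fnx] [k _ Gky]]; exists (maxn n k) => //; split.
    - by move: x Fnx; exact/subsetPset/ndF/leq_maxl.
    - by move: y Gky; exact/subsetPset/ndG/leq_maxr.
  by move=> [n _ []/= ? ?]; split; exists n.
move=> k; have [? ?] := Foo k; have [? ?] := Goo k.
split; first exact: measurableX.
by rewrite product_measure1E// lte_mul_pinfty// ge0_fin_numE.
Qed.

Section lebesgue_measure_step.
Context (R : realType) (n : nat).
Variable m : {sigma_finite_measure set (euclid R n) -> \bar R}.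

Definition consE (p : measurableTypeR R * euclid R n) : euclid R n.+1 :=
  [tuple of p.1 :: p.2].

Lemma measurable_consE : measurable_fun setT consE.
Proof. exact: measurable_cons. Qed.

Definition lebesgue_step : set (euclid R n.+1) -> \bar R :=
  pushforward (lebesgue_measure \x m)%E consE.

Let step0 : (lebesgue_step set0 = 0)%E.
Proof. by rewrite /lebesgue_step /pushforward preimage_set0 measure0. Qed.

Let step_ge0 A : (0 <= lebesgue_step A)%E.
Proof. by rewrite /lebesgue_step /pushforward; exact: measure_ge0. Qed.

Let step_sigma_additive : semi_sigma_additive lebesgue_step.
Proof.
move=> F mF tF mUF; rewrite /lebesgue_step /pushforward preimage_bigcup.
apply: measure_semi_sigma_additive.
- by move=> k; rewrite -[X in measurable X]setTI; exact: measurable_consE.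
- apply/trivIsetP => /= i j _ _ ij; rewrite -preimage_setI.
  by move/trivIsetP : tF => /(_ _ _ _ _ ij) ->//; rewrite preimage_set0.
- by rewrite -preimage_bigcup -[X in measurable X]setTI; exact: measurable_consE.
Qed.

HB.instance Definition _ := isMeasure.Build _ _ _
  lebesgue_step step0 step_ge0 step_sigma_additive.

Let step_sigma_finite : sigma_finite setT lebesgue_step.
Proof.
have [F TF Foo] := product_sigma_finite lebesgue_measure m.
pose unconsE (x : euclid R n.+1) := (thead x, [tuple of behead x]).
have unK p : unconsE (consE p) = p.
  by case: p => a t; rewrite /unconsE /consE/= theadE; congr pair; exact/val_inj.
exists (fun k => unconsE @^-1` F k).
  by rewrite -preimage_bigcup -TF preimage_setT.
move=> k; have [mF Fk] := Foo k; split.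
  rewrite -[X in measurable X]setTI.
  have mu : measurable_fun setT unconsE.
    apply/measurable_fun_pairP; split => /=.
      exact: (measurable_tnth ord0).
    exact: measurable_behead.
  exact: mu.
rewrite /lebesgue_step /pushforward -comp_preimage.
by rewrite (_ : unconsE \o consE = id)//; apply/funext.
Qed.

HB.instance Definition _ := Measure_isSigmaFinite.Build _ _ _
  lebesgue_step step_sigma_finite.

Definition lebesgue_stepM : {sigma_finite_measure set (euclid R n.+1) -> \bar R} :=
  lebesgue_step.

End lebesgue_measure_step.

Fixpoint lebesgueE (R : realType) (n : nat) :
    {sigma_finite_measure set (euclid R n) -> \bar R} :=
  match n with
  | 0 => \d_([tuple] : euclid R 0)
  | k.+1 => lebesgue_stepM (lebesgueE R k)
  end.

Lemma lebesgueE_prod (R : realType) (n : nat) (A : 'I_n -> set (measurableTypeR R)) :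
  (forall i, measurable (A i)) ->
  lebesgueE R n [set x | forall i, A i (tnth x i)] =
  (\prod_(i < n) lebesgue_measure (A i))%E.
Proof.
elim: n A => [|n IHn] A mA.
  rewrite big_ord0 /= diracE mem_set//=; last by case.
rewrite big_ord_recl /= /lebesgue_step /pushforward.
pose B := [set x : euclid R n | forall i, A (lift ord0 i) (tnth x i)].
have mB : measurable B.
  rewrite (_ : B = \big[setI/setT]_(i < n)
      ((fun x : euclid R n => tnth x i) @^-1` A (lift ord0 i))).
    apply: bigsetI_measurable => i _; rewrite -[X in measurable X]setTI.
    exact: measurable_tnth.
  rewrite -bigcap_seq; apply/seteqP; split => [x Bx i _|x + i]; first exact: Bx.
  by apply; rewrite /= mem_index_enum.
rewrite [X in (_ \x _)%E X](_ : _ = A ord0 `*` B).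
  rewrite product_measure1E//; congr (_ * _)%E.
  exact: (IHn (fun i => A (lift ord0 i))).
apply/seteqP; split => [[a t] /= Aat|[a t] /= [Aa Bt] i].
  split; first exact: (Aat ord0).
  by move=> i; have := Aat (lift ord0 i); rewrite tnthS.
by case: (unliftP ord0 i) => [j|] ->//; rewrite tnthS; exact: Bt.
Qed.

Definition unit_cube (R : realType) (n : nat) : set (euclid R n) :=
  [set x | forall i, 0 <= (tnth x i : R) <= 1].
Arguments unit_cube : clear implicits.

(* [0, X], the product of the intervals [0, X_i] *)
Definition anchored_box (R : realType) (n : nat) (X : euclid R n) :
    set (euclid R n) :=
  [set y | forall i, 0 <= (tnth y i : R) <= tnth X i].

(* |[0, X]| *)
Definition box_volume (R : realType) (n : nat) (X : euclid R n) : R :=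
  \prod_(i < n) (tnth X i : R).

Lemma lebesgueE_anchored_box (R : realType) (n : nat) (X : euclid R n) :
  X \in unit_cube R n ->
  lebesgueE R n (anchored_box X) = (box_volume X)%:E.
Proof.
rewrite inE => X01.
rewrite (_ : anchored_box X =
    [set y | forall i, [set` `[0 : R, tnth X i]] (tnth y i)]); last first.
  by apply/seteqP; split => y Hy i; have := Hy i; rewrite /= in_itv.
rewrite (lebesgueE_prod (A := fun i => [set` `[0 : R, tnth X i]])).
  rewrite /box_volume -prodEFin; apply: eq_bigr => i _.
  rewrite lebesgue_measure_itv/= lte_fin.
  have /andP[X0 _] := X01 i.
  case: ltP => [_|Xle]; first by rewrite sube0.
  by congr EFin; apply/eqP; rewrite eq_le X0 Xle.
by move=> i; exact: measurable_itv.
Qed.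

Definition discrepancy (R : realType) (n : nat) (P : {fset euclid R n})
    (X : euclid R n) : R :=
  #|` [fset p in P | p \in anchored_box X]%fset|%:R - #|` P|%:R * box_volume X.

(* Only the restriction of psi to [0, +oo[ is relevant; there psi is
   nonnegative, being increasing with psi 0 = 0. *)
Record orlicz_function (R : realType) (psi : R -> R) : Prop := {
  orlicz_function0 : psi 0 = 0 ;
  orlicz_function_incr : {in Num.nneg &, {homo psi : x y / x < y}} ;
  orlicz_function_convex : convex_function (`[0, +oo[%classic : set R) psi
}.

(* The infimum is taken in the extended reals, so that it is +oo when no K is
   admissible. *)
Definition orlicz_norm (R : realType) (n : nat) (psi : R -> R)
    (f : euclid R n -> R) : \bar R :=
  ereal_inf [set K%:E | K in [set K : R | 0 < K /\
    (\int[lebesgueE R n]_(x in unit_cube R n) (psi (`|f x| / K))%:E <= 1)%E]].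

(* psi is one of the functions whose Orlicz space is exp(L^alpha) *)
Definition exp_orlicz_function (R : realType) (alpha : R) (psi : R -> R) : Prop :=
  orlicz_function psi /\
  \forall x \near +oo, psi x = expR (x `^ alpha) - 1.

(* Main.v *)
(** The points are a digital net in base 2 over the polynomials of F_2[X] of
    degree < m (digits in bases given by pairwise coprime polynomials), shifted
    digitwise by random bits T.

    For a fixed corner of the box, expanding the indicator of each factor in
    Haar-type functions writes the discrepancy as a sum over levels
    r = (r_1, ..., r_n) of terms X_r(T) which vanish when 0 < r_1 + ... + r_n <= m - t,
    are bounded by a constant, and are nonzero with probability O(2^-s) when
    r_1 + ... + r_n = m - t + s.  For s fixed, r_n is determined by the other
    levels, and flipping one bit of T makes the sum over each of r_1, ..., r_(n-1)
    a martingale: since L^2q is 2-smooth with constant O(q), the L^2q norm of the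
    sum is O((q m)^((n-1)/2) 2^(-s/2q)).  Summing over s costs another factor q, so
    the moments grow like q^((n+1)/2), which is exponential integrability of order
    2/(n+1) uniformly in the corner.  Averaging over T gives one good shift.

    For general N, with 2^(m-1) < N <= 2^m, one keeps the N points whose first
    coordinate is less than N 2^-m and stretches that coordinate. *)

Require Import Defs.
From mathcomp Require Import all_boot all_order all_algebra finmap.
From mathcomp Require Import all_classical all_reals all_analysis.
From mathcomp Require Import measurable_realfun.
From mathcomp Require Import ring lra zify.
Import Order.TTheory GRing.Theory Num.Theory.
Import numFieldNormedType.Exports.

Set Implicit Arguments.
Unset Strict Implicit.
Unset Printing Implicit Defensive.

Local Open Scope ring_scope.

(** * Moment inequalities *)

(** The graph of the convex function [u ^+ k.+1] lies above its tangent at [c]. The induction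
    multiplies by [c] and adds the nonnegative product of two differences of the same sign, so no
    derivative is taken. *)
Lemma expr_tangent (R : realFieldType) (k : nat) (c u : R) : 0 <= c -> 0 <= u ->
  k.+1%:R * c ^+ k * u <= u ^+ k.+1 + k%:R * c ^+ k.+1.
Proof.
move=> c0 u0; elim: k => [|k IHk]; first by rewrite expr0 expr1 mulr0n mul0r addr0 !mul1r.
have mono : 0 <= (u ^+ k.+1 - c ^+ k.+1) * (u - c).
  have [uc|/ltW uc] := leP c u.
    by rewrite mulr_ge0// subr_ge0// lerXn2r.
  by rewrite mulr_le0// subr_le0// lerXn2r.
have : c * (k.+1%:R * c ^+ k * u) <= c * (u ^+ k.+1 + k%:R * c ^+ k.+1).
  exact: ler_wpM2l.
move: mono; rewrite !exprS -[in k.+2%:R]natr1 -[in k.+1%:R]natr1.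
move: (u ^+ k) (c ^+ k) => U V; nra.
Qed.

Section moments.
Context (R : realFieldType) (I : finType).
Implicit Types (f g : I -> R) (A B W : R).

(** Minkowski's inequality with no root taken: a bound [A ^+ k.+1 * W] on the moment stands for a
    norm at most [A], up to the common weight [W]. It follows from Jensen's inequality for
    normalised functions. *)
Lemma minkowski_exprn (k : nat) f g A B W :
  (forall i, 0 <= f i) -> (forall i, 0 <= g i) -> 0 <= A -> 0 <= B ->
  \sum_i f i ^+ k.+1 <= A ^+ k.+1 * W -> \sum_i g i ^+ k.+1 <= B ^+ k.+1 * W ->
  \sum_i (f i + g i) ^+ k.+1 <= (A + B) ^+ k.+1 * W.
Proof.
move=> f0 g0 + + hf hg.
(* The main argument divides by [A] and [B]; if one of them is zero, the corresponding function
   vanishes identically. *)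
have vanish (h : I -> R) : (forall i, 0 <= h i) -> \sum_i h i ^+ k.+1 <= 0 ^+ k.+1 * W ->
    forall i, h i = 0.
  move=> h0; rewrite expr0n/= mul0r => hs i.
  have /eqP := @psumr_eq0P R I xpredT (fun i => h i ^+ k.+1) (fun i _ => exprn_ge0 _ (h0 i))
    (le_anti (introT andP (conj hs (sumr_ge0 _ (fun i _ => exprn_ge0 _ (h0 i)))))) i isT.
  by rewrite expf_eq0/= => /eqP.
rewrite le_eqVlt => /predU1P[A0|A0].
  move: hf; rewrite -A0 => /(vanish _ f0) f00 _.
  by under eq_bigr => i _ do rewrite f00 add0r; rewrite add0r.
rewrite le_eqVlt => /predU1P[B0|B0].
  move: hg; rewrite -B0 => /(vanish _ g0) g00.
  by under eq_bigr => i _ do rewrite g00 addr0; rewrite addr0.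
have AB0 : 0 < A + B by rewrite addr_gt0.
have ptw i : (f i + g i) ^+ k.+1 <=
    (A + B) ^+ k * (A * (f i / A) ^+ k.+1 + B * (g i / B) ^+ k.+1).
  (* [c] is the mean of [f i / A] and [g i / B] with weights proportional to [A] and [B]; the
     tangents at [c], added with these weights, give the pointwise Jensen inequality. *)
  pose c := (f i + g i) / (A + B).
  have c0 : 0 <= c by rewrite divr_ge0// ?addr_ge0// ltW.
  have fgE : f i + g i = (A + B) * c by rewrite /c mulrC divfK// gt_eqF.
  have t1 := expr_tangent k c0 (divr_ge0 (f0 i) (ltW A0)).
  have t2 := expr_tangent k c0 (divr_ge0 (g0 i) (ltW B0)).
  rewrite {1}fgE exprMn exprSr -mulrA ler_wpM2l ?exprn_ge0 ?(ltW AB0)//.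
  have {}t1 := ler_wpM2l (ltW A0) t1.
  have {}t2 := ler_wpM2l (ltW B0) t2.
  have e1 : A * (k.+1%:R * c ^+ k * (f i / A)) = k.+1%:R * c ^+ k * f i.
    by field; rewrite gt_eqF.
  have e2 : B * (k.+1%:R * c ^+ k * (g i / B)) = k.+1%:R * c ^+ k * g i.
    by field; rewrite gt_eqF.
  have e3 : k.+1%:R * c ^+ k * f i + k.+1%:R * c ^+ k * g i
      = k%:R * (A + B) * c ^+ k.+1 + (A + B) * c ^+ k.+1.
    by rewrite -mulrDr fgE exprS -natr1; ring.
  rewrite e1 in t1; rewrite e2 in t2.
  move: t1 t2 e3; rewrite !mulrDr.
  move: (k.+1%:R * c ^+ k * f i) (k.+1%:R * c ^+ k * g i) => X Y.
  move: (A * (f i / A) ^+ k.+1) (B * (g i / B) ^+ k.+1) (c ^+ k.+1) => Z T U.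
  move: (k%:R : R) => K; lra.
apply: le_trans (ler_sum _ (fun i _ => ptw i)) _.
rewrite -mulr_sumr big_split/= -!mulr_sumr exprSr -[leRHS]mulrA.
rewrite ler_wpM2l ?exprn_ge0 ?(ltW AB0)// mulrDl lerD// ler_wpM2l ?(ltW A0) ?(ltW B0)//.
- under eq_bigr => i _ do rewrite expr_div_n.
  by rewrite -mulr_suml ler_pdivrMr ?exprn_gt0// mulrC.
- under eq_bigr => i _ do rewrite expr_div_n.
  by rewrite -mulr_suml ler_pdivrMr ?exprn_gt0// mulrC.
Qed.

Lemma minkowski_sum (k m : nat) (f : nat -> I -> R) (a : nat -> R) W :
  (forall s i, 0 <= f s i) -> (forall s, 0 <= a s) -> 
  (forall s, (s < m)%N -> \sum_i f s i ^+ k.+1 <= a s ^+ k.+1 * W) ->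
  \sum_i (\sum_(s < m) f s i) ^+ k.+1 <= (\sum_(s < m) a s) ^+ k.+1 * W.
Proof.
move=> f0 a0; elim: m => [|m IHm] hf.
  rewrite big_ord0 expr0n/= mul0r big1// => i _.
  by rewrite big_ord0 expr0n.
under eq_bigr => i _ do rewrite big_ord_recr/=.
rewrite big_ord_recr/=; apply: minkowski_exprn => //.
- by move=> i; exact: sumr_ge0.
- exact: sumr_ge0.
- by apply: IHm => s sm; apply: hf; exact: ltnW.
- exact: hf.
Qed.

(* The half-sum P k of (x + y)^2k and (x - y)^2k satisfies
   P k.+2 <= (x^2 + y^2) P k.+1 + 4 k.+1 x^2 y^2 P k. *)
Lemma symmetrized_power_le (k : nat) (x y : R) :
  ((x + y) ^+ 2 ^+ k + (x - y) ^+ 2 ^+ k) / 2 <= (x ^+ 2 + 4 * k%:R * y ^+ 2) ^+ k.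
Proof.
pose P k := ((x + y) ^+ 2 ^+ k + (x - y) ^+ 2 ^+ k) / 2.
pose r := 2 * x * y.
pose Q k := r * (((x + y) ^+ 2 ^+ k - (x - y) ^+ 2 ^+ k) / 2).
pose s := x ^+ 2 + y ^+ 2.
have PS j : P j.+1 = s * P j + Q j.
  rewrite /P /Q /r /s !(exprS _ j).
  by move: ((x + y) ^+ 2 ^+ j) ((x - y) ^+ 2 ^+ j) => U V; field.
have QS j : Q j.+1 = s * Q j + r ^+ 2 * P j.
  rewrite /P /Q /r /s !(exprS _ j).
  by move: ((x + y) ^+ 2 ^+ j) ((x - y) ^+ 2 ^+ j) => U V; field.
have P0 j : 0 <= P j by rewrite divr_ge0// addr_ge0// exprn_ge0// sqr_ge0.
have s0 : 0 <= s by rewrite addr_ge0// sqr_ge0.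
have Q0 j : 0 <= Q j.
  elim: j => [|j IHj]; first by rewrite /Q !expr0 subrr mul0r mulr0.
  by rewrite QS addr_ge0// mulr_ge0// sqr_ge0.
have QP j : Q j.+1 <= j.+1%:R * r ^+ 2 * P j.
  elim: j => [|j IHj].
    by rewrite QS [X in s * X](_ : _ = 0) ?mulr0 ?add0r ?mul1r// /Q !expr0 subrr mul0r mulr0.
  rewrite QS [leRHS](_ : _ = j.+1%:R * r ^+ 2 * P j.+1 + r ^+ 2 * P j.+1); last first.
    by rewrite -(natr1 j.+1); ring.
  rewrite lerD2r.
  apply: le_trans (ler_wpM2l s0 IHj) _.
  rewrite mulrCA; apply: ler_wpM2l; first by rewrite mulr_ge0// sqr_ge0.
  by rewrite PS lerDl.
(* The constant [4 * l] must stay fixed while the exponent [j] descends, so the two are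
   separated. *)
suff main l j : (j <= l)%N -> P j <= (x ^+ 2 + 4 * l%:R * y ^+ 2) ^+ j by exact: main.
set w := (x ^+ 2 + 4 * l%:R * y ^+ 2).
have w0 : 0 <= w by apply: addr_ge0 (sqr_ge0 _) (mulr_ge0 (mulr_ge0 _ _) (sqr_ge0 _)).
elim/ltn_ind: j => -[|[|j]] IHj jl.
- by rewrite /P !expr0; lra.
- rewrite /P !expr1 /w.
  have : 1 <= l%:R :> R by rewrite ler1n.
  have := sqr_ge0 y; have := sqr_ge0 x; move: (l%:R : R) => K; nra.
- have h1 := IHj j.+1 (ltnSn _) (ltnW jl).
  have h2 := IHj j (leqW (leqnn _)) (ltnW (ltnW jl)).
  rewrite PS.
  have {}h1 := ler_wpM2l s0 h1.
  have c0 : 0 <= j.+1%:R * r ^+ 2 :> R by rewrite mulr_ge0// sqr_ge0.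
  have {}h2 := le_trans (QP j) (ler_wpM2l c0 h2).
  apply: le_trans (lerD h1 h2) _.
  rewrite !(exprS w) !mulrA -mulrDl ler_wpM2r ?exprn_ge0//.
  rewrite /s /r /w.
  have lj : j.+1%:R + 1 <= l%:R :> R by rewrite natr1 ler_nat.
  have l1 : 1 <= l%:R :> R by rewrite ler1n; apply: leq_trans jl.
  move: lj l1; move: (l%:R : R) (j.+1%:R : R) => L J lj l1.
  have := sqr_ge0 y; have := sqr_ge0 x.
  have -> : J * 2 * x * y * 2 * x * y = 4 * J * (x ^+ 2 * y ^+ 2) by ring.
  move: (x ^+ 2) (y ^+ 2) => X Y X0 Y0.
  have XY : 0 <= X * Y by rewrite mulr_ge0.
  have : 0 <= (L - J - 1) * (X * Y) by rewrite mulr_ge0//; lra.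
  have LL : 0 <= L * ((L - 1) * (Y * Y)).
    by rewrite !mulr_ge0// ?subr_ge0//; lra.
  have LYY : 0 <= L * (Y * Y) by rewrite !mulr_ge0//; lra.
  nra.
Qed.

(** [sigma v] negates the difference [d v] and preserves all earlier ones, so the moment of a
    partial sum plus [d v] equals its symmetrization. By [symmetrized_power_le] and Minkowski for
    the squares, each new difference adds at most [4 * q.+1 * B] to the norm of the square. *)
Lemma martingale_moment (q M : nat) (d : nat -> I -> R) (sigma : nat -> I -> I) B W :
  0 <= B ->
  (forall v, involutive (sigma v)) ->
  (forall v i, (0 < v < M)%N -> d v (sigma v i) = - d v i) ->
  (forall v v' i, (v' < v < M)%N -> d v' (sigma v i) = d v' i) ->
  (forall v, (v < M)%N -> \sum_i d v i ^+ 2 ^+ q.+1 <= B ^+ q.+1 * W) ->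
  \sum_i (\sum_(v < M) d v i) ^+ 2 ^+ q.+1 <=
    (4 * q.+1%:R * M%:R * B) ^+ q.+1 * W.
Proof.
move=> B0 sigmaK dN dinv dB.
have W0 : (0 < M)%N -> 0 <= B ^+ q.+1 * W.
  move=> M0; apply: le_trans (dB 0%N M0).
  by apply: sumr_ge0 => i _; rewrite exprn_ge0// sqr_ge0.
case: M dN dinv dB W0 => [|M] dN dinv dB W0.
  rewrite mulr0 mul0r expr0n mul0r big1// => i _.
  by rewrite big_ord0 !expr0n.
(* The initial term [d 0] need not be antisymmetric; it contributes the separate summand [B]. *)
suff main k : (k <= M)%N -> \sum_i (\sum_(v < k.+1) d v i) ^+ 2 ^+ q.+1 <=
    (B + 4 * q.+1%:R * k%:R * B) ^+ q.+1 * W.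
  apply: le_trans (main M (leqnn _)) _.
  rewrite [X in X ^+ q.+1](_ : _ = (1 + 4 * q.+1%:R * M%:R) * B); last by ring.
  rewrite 2!exprMn -!mulrA ler_wpM2r ?W0// lerXn2r// ?nnegrE.
  - by rewrite addr_ge0// !mulr_ge0.
  - by rewrite !mulr_ge0.
  - rewrite -(natr1 M).
    have : 1 <= q.+1%:R :> R by rewrite ler1n.
    move: (q.+1%:R : R) (M%:R : R) => X Y X1; nra.
elim: k => [|k IHk] kM.
  under eq_bigr => i _ do rewrite big_ord1.
  by rewrite mulr0 mul0r addr0; exact: dB.
pose F i := \sum_(v < k.+1) d v i.
have E1 : \sum_i (\sum_(v < k.+2) d v i) ^+ 2 ^+ q.+1 =
    \sum_i (F i + d k.+1 i) ^+ 2 ^+ q.+1.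
  by apply: eq_bigr => i _; rewrite big_ord_recr.
have E2 : \sum_i (F i + d k.+1 i) ^+ 2 ^+ q.+1 =
    \sum_i (F i - d k.+1 i) ^+ 2 ^+ q.+1.
  rewrite (reindex_inj (inv_inj (sigmaK k.+1)))/=; apply: eq_bigr => i _.
  rewrite dN ?ltnS//; congr ((_ - _) ^+ _ ^+ _).
  by apply: eq_bigr => v _; rewrite dinv// ltn_ord/=.
have E3 : \sum_i (F i + d k.+1 i) ^+ 2 ^+ q.+1 =
    \sum_i ((F i + d k.+1 i) ^+ 2 ^+ q.+1 + (F i - d k.+1 i) ^+ 2 ^+ q.+1) / 2.
  by rewrite -mulr_suml big_split/= -E2; field.
rewrite E1 E3.
apply: le_trans (ler_sum _ (fun i _ => symmetrized_power_le q.+1 (F i) (d k.+1 i))) _.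
rewrite [X in _ <= X ^+ _ * _](_ : _ = (B + 4 * q.+1%:R * k%:R * B) + 4 * q.+1%:R * B);
  last by rewrite -(natr1 k); ring.
apply: minkowski_exprn.
- by move=> i; exact: sqr_ge0.
- by move=> i; apply: mulr_ge0 (sqr_ge0 _); exact: mulr_ge0.
- by rewrite addr_ge0// !mulr_ge0.
- by rewrite !mulr_ge0.
- by apply: IHk; exact: ltnW.
- under eq_bigr => i _ do rewrite exprMn.
  rewrite -mulr_sumr (exprMn _ _ B) -mulrA ler_wpM2l ?exprn_ge0 ?mulr_ge0//.
  exact: dB.
Qed.

End moments.

(** * Haar expansion of boxes *)

Section bits.

Fixpoint bits_num (m : nat) (u : nat -> bool) : nat :=
  if m is k.+1 then (u 0 * 2 ^ k + bits_num k (u \o S))%N else 0%N.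

Lemma bits_num_lt m u : (bits_num m u < 2 ^ m)%N.
Proof.
elim: m u => [//|m IHm] u /=; have := IHm (u \o S).
by rewrite expnS; case: (u 0); move: (2 ^ m)%N (bits_num _ _) => x y; lia.
Qed.

Lemma bits_num_surj m A : (A < 2 ^ m)%N -> exists u, bits_num m u = A.
Proof.
elim: m A => [|m IHm] A; first by case: A => // _; exists xpred0.
rewrite expnS => hA.
have [Am|mA] := ltnP A (2 ^ m).
  by have [u <-] := IHm _ Am; exists (fun i => if i is j.+1 then u j else false).
have [|u hu] := IHm (A - 2 ^ m)%N.
  by move: (2 ^ m)%N hA mA => x; lia.
exists (fun i => if i is j.+1 then u j else true) => /=.
by rewrite [bits_num _ _]hu mul1n subnKC.
Qed.

Lemma bits_num_inj m u v : bits_num m u = bits_num m v ->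
  forall i, (i < m)%N -> u i = v i.
Proof.
elim: m u v => [//|m IHm] u v /= h.
have lu := bits_num_lt m (u \o S); have lv := bits_num_lt m (v \o S).
have uv0 : u 0 = v 0.
  move: h lu lv; case: (u 0); case: (v 0) => //;
  move: (2 ^ m)%N (bits_num m _) (bits_num m _) => x y z; lia.
move: h; rewrite uv0 => /addnI h [_//|i]; rewrite ltnS; exact: (IHm _ _ h).
Qed.

Lemma bits_num_leS m u a : (bits_num m.+1 u <= bits_num m.+1 a)%N =
  if u 0 == a 0 then (bits_num m (u \o S) <= bits_num m (a \o S))%N else a 0.
Proof.
have := bits_num_lt m (u \o S); have := bits_num_lt m (a \o S).
move=> /=; case: (u 0) (a 0) => -[] //=; rewrite ?mul1n ?mul0n ?add0n ?leq_add2l//;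
move: (2 ^ m)%N (bits_num m _) (bits_num m _) => x y z; lia.
Qed.

End bits.

Section haar.
Context (R : realFieldType).

(* The Haar-type function of level r evaluated through the agreement pattern
   beta between the bits of a point and those of the corner of a box; level 0
   is the constant function. *)
Definition haar (r : nat) (beta : nat -> bool) : R :=
  if r is k.+1 then (all beta (iota 0 k))%:R * (if beta k then 1 else -1) else 1.

Arguments haar : simpl never.

Lemma haarSS r beta : haar r.+2 beta = (beta 0)%:R * haar r.+1 (beta \o S).
Proof.
rewrite /haar/= (iotaDl 1 0) all_map.
by rewrite -mulnb natrM mulrA.
Qed.

(** Induction on the leading bit: if it agrees with that of [a], the comparison passes to the tails,
    and otherwise it is the constant [a 0]. Only Haar functions on dyadic intervals around [a]
    occur, and [c 0] is the mean of the indicator. *)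
Lemma haar_expansion m a : exists c : nat -> R,
  [/\ forall r, `|c r| <= 1, c 0 = (bits_num m a).+1%:R / 2 ^+ m &
    forall u, (bits_num m u <= bits_num m a)%:R =
      \sum_(r < m.+1) c r * haar r (fun i => u i == a i)].
Proof.
elim: m a => [|m IHm] a.
  exists (fun=> 1); split => [r||u]; rewrite ?normr1 ?expr0 ?divr1//.
  by rewrite big_ord1 mul1r.
have [c [c1 c0 hc]] := IHm (a \o S).
pose tau k b : R := (bits_num k b).+1%:R / 2 ^+ k.
have tau01 k b : 0 <= tau k b <= 1.
  rewrite divr_ge0 ?exprn_ge0//= ler_pdivrMr ?exprn_gt0// mul1r -natrX ler_nat.
  exact: bits_num_lt.
have tauE : tau m.+1 a = ((a 0)%:R + tau m (a \o S)) / 2.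
  rewrite /tau/= -addnS natrD natrM natrX exprS.
  by field; rewrite expf_neq0 ?pnatr_eq0.
(* Level 1 takes half the difference between the mean on the agreeing half and the value [a 0] on
   the other half; finer levels are those of the tail. *)
pose c' r := match r with 0 => tau m.+1 a | 1 => (tau m (a \o S) - (a 0)%:R) / 2
             | k.+2 => c k.+1 end.
exists c'; split => // [[|[|r]]|u].
- by have /andP[t0 t1] := tau01 m.+1 a; rewrite ger0_norm.
- have /andP[t0 t1] := tau01 m (a \o S); rewrite /c' ler_norml.
  by case: (a 0) => /=; apply/andP; split; lra.
- exact: c1.
- rewrite 2!big_ord_recl /= bits_num_leS.
  rewrite (eq_bigr (fun i : 'I_m => (u 0 == a 0)%:R *
      (c i.+1 * haar i.+1 (fun j => u j.+1 == a j.+1)))); last first.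
    by move=> i _; rewrite /bump/= !add1n /c' haarSS mulrCA.
  rewrite -mulr_sumr.
  have := hc (u \o S); rewrite big_ord_recl/= c0 mulr1 => /eqP.
  rewrite addrC -subr_eq => /eqP; rewrite /bump/=.
  under eq_bigr do rewrite add1n.
  move=> <-; rewrite -/(tau m (a \o S)) tauE /haar/= mulr1 mul1r.
  have [_|h] := boolP (u 0 == a 0).
    by rewrite /=; lra.
  rewrite mul0r addr0; case: (a 0) => /=; lra.
Qed.

Lemma haar_agree r beta : `|haar r beta| <= (all beta (iota 0 r.-1))%:R.
Proof.
case: r => [|r]; rewrite /haar/=; first by rewrite normr1.
by rewrite normrM normr_nat; case: ifP => _; rewrite ?normrN normr1 mulr1.
Qed.

Lemma haar_flip r i beta beta' : (r <= i)%N ->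
  (forall k, (k < i)%N -> beta' k = beta k) -> haar r beta' = haar r beta.
Proof.
case: r => [//|r] ri h; rewrite /haar/= h//; congr (_%:R * _).
congr nat_of_bool; apply: eq_in_all => k; rewrite mem_iota add0n => kr.
by rewrite h//; exact: ltn_trans ri.
Qed.

(** Together with [haar_flip], this turns the toggling of one bit into a sign change at one level
    and invariance at coarser levels, which is the martingale structure. *)
Lemma haar_neg r beta beta' : beta' r = ~~ beta r ->
  (forall k, (k < r)%N -> beta' k = beta k) -> haar r.+1 beta' = - haar r.+1 beta.
Proof.
move=> hr h; rewrite /haar/= hr -mulrN; congr (_ * _).
  congr (nat_of_bool _)%:R; apply: eq_in_all => k; rewrite mem_iota add0n => kr.
  exact: h.
by case: (beta r); rewrite //= opprK.
Qed.

End haar.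

(** * Iterated martingale estimate on a fixed total level *)

Section iterated.
Context (R : realFieldType) (I : finType) (n M q : nat).
Variable X : {ffun 'I_n.+1 -> 'I_M.+1} -> I -> R.
Variable sigma : 'I_n.+1 -> nat -> I -> I.
Hypothesis sigmaK : forall j v, involutive (sigma j v).
Hypothesis X_neg : forall (r : {ffun 'I_n.+1 -> 'I_M.+1}) (j : 'I_n.+1) w,
  (0 < r j)%N -> X r (sigma j (r j) w) = - X r w.
Hypothesis X_inv : forall (r : {ffun 'I_n.+1 -> 'I_M.+1}) (j : 'I_n.+1) v w,
  (r j < v <= M)%N -> X r (sigma j v w) = X r w.
Variables (L : nat) (B W : R).
Hypothesis B0 : 0 <= B.
Hypothesis W0 : 0 <= W.
Hypothesis X_moment : forall r : {ffun 'I_n.+1 -> 'I_M.+1}, (\sum_j r j = L)%N ->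
  \sum_w X r w ^+ 2 ^+ q.+1 <= B ^+ q.+1 * W.

(** One application of [martingale_moment] for each of the first [n] coordinates. The last
    coordinate costs nothing, because the total level [L] determines it. *)
Lemma iterated_moment :
  \sum_w (\sum_(r : {ffun 'I_n.+1 -> 'I_M.+1} | (\sum_j r j == L)%N) X r w) ^+ 2 ^+ q.+1 <=
  ((4 * q.+1%:R * M.+1%:R) ^+ n * B) ^+ q.+1 * W.
Proof.
(* [k] counts the coordinates summed freely besides the last one; those before them are frozen at
   the values of [rho]. *)
suff main k (rho : {ffun 'I_n.+1 -> 'I_M.+1}) : (k <= n)%N ->
    \sum_w (\sum_(r : {ffun 'I_n.+1 -> 'I_M.+1} |
        [forall i : 'I_n.+1, (i < n - k)%N ==> (r i == rho i)] &&
        (\sum_j r j == L)%N) X r w) ^+ 2 ^+ q.+1 <=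
    ((4 * q.+1%:R * M.+1%:R) ^+ k * B) ^+ q.+1 * W.
  have := main n [ffun=> ord0] (leqnn _); rewrite subnn.
  congr (_ <= _); apply: eq_bigr => w _; congr (_ ^+ _ ^+ _).
  by apply: eq_bigl => r; rewrite (_ : [forall _, _])//; apply/forallP.
elim: k rho => [|k IHk] rho kn.
  rewrite subn0 expr0 mul1r.
  (* With all coordinates but the last frozen, at most one level vector has total [L], and the sum
     has at most one term. *)
  pose Q (r : {ffun 'I_n.+1 -> 'I_M.+1}) :=
    [forall i : 'I_n.+1, (i < n)%N ==> (r i == rho i)] && (\sum_j r j == L)%N.
  have [r0 /andP[/forallP r0rho /eqP r0L]|noQ] := pickP Q; last first.
    rewrite big1 ?mulr_ge0 ?exprn_ge0// => w _.
    by rewrite big_pred0// !expr0n.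
  rewrite (eq_bigr (fun w => X r0 w ^+ 2 ^+ q.+1)); first exact: X_moment.
  move=> w _; rewrite (big_pred1 r0)// => r /=.
  apply/idP/eqP => [/andP[/forallP rrho /eqP rL]|->]; last first.
    by apply/andP; split; [exact/forallP | exact/eqP].
  have eqn (i : 'I_n.+1) : (i < n)%N -> r i = r0 i.
    by move=> i_n; have /eqP -> := implyP (rrho i) i_n; have /eqP -> := implyP (r0rho i) i_n.
  apply/ffunP => i; have [/eqn//|ni] := ltnP i n.
  have -> : i = ord_max by apply/val_inj => /=; have := ltn_ord i; lia.
  apply/val_inj => /=; move: rL; rewrite -r0L !big_ord_recr/=.
  rewrite (eq_bigr (fun i : 'I_n => r0 (widen_ord (leqnSn n) i) : nat)).
    by move/addnI.
  by move=> j _; rewrite eqn//=.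
(* The coordinate released at this stage; its level serves as martingale time. *)
pose j : 'I_n.+1 := inord (n - k.+1).
have jE : j = (n - k.+1)%N :> nat by rewrite inordK//; lia.
pose rhov (v : 'I_M.+1) := [ffun i => if i == j then v else rho i].
pose d (v : nat) (w : I) := \sum_(r : {ffun 'I_n.+1 -> 'I_M.+1} |
  [forall i : 'I_n.+1, (i < n - k.+1)%N ==> (r i == rho i)] &&
        (\sum_j r j == L)%N && (r j == v :> nat)) X r w.
rewrite (eq_bigr (fun w => (\sum_(v < M.+1) d v w) ^+ 2 ^+ q.+1)); last first.
  move=> w _; congr (_ ^+ _ ^+ _).
  by rewrite (partition_big (fun r : {ffun 'I_n.+1 -> 'I_M.+1} => r j) xpredT).
rewrite (exprS _ k) -(mulrA _ _ B).
apply: (@martingale_moment _ _ _ _ _ (sigma j)) => //.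
- by rewrite mulr_ge0// exprn_ge0// !mulr_ge0.
- move=> v w /andP[v0 vM]; rewrite /d -sumrN; apply: eq_bigr => r /andP[_ /eqP rv].
  by rewrite -rv X_neg// rv.
- move=> v v' w /andP[v'v vM]; rewrite /d; apply: eq_bigr => r /andP[_ /eqP rv].
  by apply: X_inv; rewrite rv v'v.
- move=> v vM; have := IHk (rhov (Ordinal vM)) (ltnW kn).
  congr (_ <= _); apply: eq_bigr => w _; congr (_ ^+ _ ^+ _).
  apply: eq_bigl => r; rewrite andbAC; congr (_ && _).
  apply/forallP/andP => [h|[/forallP h /eqP rj] i].
    split.
      apply/forallP => i; apply/implyP => ik.
      have := h i; rewrite (leq_trans ik) ?leq_sub2l//= ffunE ifN//.
      by apply: contraTneq ik => ->; rewrite jE ltnn.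
    have := h j; rewrite jE ltn_sub2l//= ffunE eqxx => /eqP -> //.
  apply/implyP => ik; rewrite ffunE; case: (eqVneq i j) => [->|ij].
    by rewrite -val_eqE/= rj.
  apply: implyP (h i) _; rewrite ltn_neqAle -jE ij/= jE.
  by move: ik ij; lia.
Qed.

End iterated.

(** * Digital nets *)

Section adic_digits.
Context (F : fieldType).
Implicit Types (a f g : {poly F}) (q c : nat).

Definition adic_digit a f q : {poly F} := iter q (fun h => h %/ a) f %% a.

Lemma adic_digitD a f g q : adic_digit a (f + g) q = adic_digit a f q + adic_digit a g q.
Proof.
rewrite /adic_digit -modpD; congr (_ %% _).
by elim: q => //= q ->; rewrite divpD.
Qed.

Lemma adic_digit_dvd a f q c : a != 0 -> (q < c)%N -> a ^+ c %| f ->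
  adic_digit a f q = 0.
Proof.
move=> a0 qc /dvdpP[h ->]; rewrite /adic_digit.
rewrite (_ : iter _ _ _ = h * a ^+ (c - q)).
  by rewrite -(subnSK qc) exprSr mulrA modp_mull.
elim: q qc => [|q IHq] qc; first by rewrite subn0.
by rewrite iterS IHq 1?ltnW// -(subnSK (ltnW qc)) exprSr mulrA mulpK.
Qed.

Lemma adic_digit_surj a (D : nat -> {poly F}) c :
  a != 0 -> (forall q, (size (D q) < size a)%N) ->
  exists f, forall q, (q < c)%N -> adic_digit a f q = D q.
Proof.
move=> a0; elim: c D => [|c IHc] D hD; first by exists 0.
have [f hf] := IHc (fun q => D q.+1) (fun q => hD q.+1).
exists (f * a + D 0%N) => -[_|q qc].
  by rewrite /adic_digit/= modpD modp_mull add0r modp_small.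
by rewrite /adic_digit iterSr divp_addl_mul_small//; exact: hf.
Qed.

Lemma chinese_poly (A g : nat -> {poly F}) (k : nat) :
  (forall i j, (i < j)%N -> coprimep (A i) (A j)) ->
  exists f, forall j, (j < k)%N -> A j %| f - g j.
Proof.
move=> cA; elim: k => [|k [f hf]]; first by exists 0.
pose P := \prod_(j < k) A j.
have /Bezout_eq1_coprimepP[[u v]/= uv] : coprimep P (A k).
  rewrite /P; elim/big_ind : _ => [|p q cp cq|i _]; first exact: coprime1p.
    by rewrite coprimepMl cp.
  exact: cA.
(* [u * P] is 1 modulo [A k] and 0 modulo each earlier [A j]. *)
exists (f + u * P * (g k - f)) => j; rewrite ltnS leq_eqVlt => /predU1P[->|jk].
  rewrite (_ : _ - _ = (f - g k) * (v * A k)).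
    by rewrite mulrA dvdp_mulIr.
  have -> : v * A k = 1 - u * P by rewrite -uv; ring.
  by ring.
rewrite addrAC dvdp_add ?hf// -mulrA dvdp_mull// dvdp_mulr//.
by rewrite /P (bigD1 (Ordinal jk))//= dvdp_mulr.
Qed.

End adic_digits.

Section sylvester.
Context (F : fieldType).

Fixpoint sylvester_prod (j : nat) : {poly F} :=
  if j is i.+1 then sylvester_prod i * (1 + sylvester_prod i) else 'X.

(* Pairwise coprime nonconstant polynomials, by Euclid's argument. *)
Definition sylvester (j : nat) : {poly F} :=
  if j is i.+1 then 1 + sylvester_prod i else 'X.

Lemma size_sylvester_prod j : (1 < size (sylvester_prod j))%N.
Proof.
elim: j => [|j IHj] /=; first by rewrite size_polyX.
have s1 : size (1 + sylvester_prod j) = size (sylvester_prod j).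
  by rewrite addrC size_polyDl// size_poly1.
have P0 : sylvester_prod j != 0 by rewrite -size_poly_gt0 ltnW.
have Q0 : 1 + sylvester_prod j != 0 by rewrite -size_poly_gt0 s1 ltnW.
by rewrite size_mul// s1; move: (size _) IHj => k; lia.
Qed.

Lemma size_sylvester j : (1 < size (sylvester j))%N.
Proof.
case: j => [|j] /=; first by rewrite size_polyX.
by rewrite addrC size_polyDl ?size_sylvester_prod// size_poly1 size_sylvester_prod.
Qed.

Lemma sylvester_dvd i j : (i <= j)%N -> sylvester i %| sylvester_prod j.
Proof.
elim: j => [|j IHj] /=; first by rewrite leqn0 => /eqP->.
rewrite leq_eqVlt => /predU1P[->|]; first by rewrite dvdp_mulIr.
by rewrite ltnS => /IHj; exact: dvdp_mulr.
Qed.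

Lemma coprimep_sylvester i j : (i < j)%N -> coprimep (sylvester i) (sylvester j).
Proof.
case: j => // j; rewrite ltnS => /sylvester_dvd ij.
apply: coprimep_dvdr ij _; apply/Bezout_eq1_coprimepP.
by exists (-1, 1) => /=; ring.
Qed.

End sylvester.

(* A digital net in base 2 over the points f of F_2[X] of degree < m: the bits
   of the j-th coordinate are those of the sylvester j-adic digits of f. *)
Lemma digital_net_exists (n : nat) : exists t : nat, forall m : nat,
  exists B : 'rV['F_2]_m -> nat -> nat -> bool,
  [/\ forall p w j i, B (p + w) j i = B p j i (+) B w j i,
      forall d : nat -> nat, (\sum_(j < n) d j + t <= m)%N ->
        forall z : nat -> nat -> bool, exists p,
          forall j i, (j < n)%N -> (i < d j)%N -> B p j i = z j i &
      forall p p', (forall i, (i < m)%N -> B p 0 i = B p' 0 i) -> p = p'].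
Proof.
pose a j := sylvester 'F_2 j; pose e j := (size (a j)).-1.
have sa j : size (a j) = (e j).+1 by rewrite /e prednK// ltnW// size_sylvester.
have e0 j : (0 < e j)%N by rewrite -ltnS -sa size_sylvester.
have a0 j : a j != 0 by rewrite -size_poly_gt0 sa.
have F2 (x y : 'F_2) : (x + y != 0) = (x != 0) (+) (y != 0).
  by case: x y => [[|[|//]] ?] [[|[|//]] ?]; rewrite -!val_eqE.
(* Prescribing [d j] bits means prescribing whole digits of [e j] bits each; rounding up costs at
   most [e j] in coordinate [j]. *)
exists (\sum_(j < n) e j)%N => m.
pose B (p : 'rV['F_2]_m) j i :=
  (adic_digit (a j) (rVpoly p) (i %/ e j))`_(i %% e j) != 0.
exists B; split=> [p w j i|d dm z|p p' pp'].
- by rewrite /B linearD/= adic_digitD coefD F2.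
(* [c j] digits cover the first [d j] bits, and prescribing them means fixing [f] modulo
   [a j ^+ c j]. *)
- pose c j := (d j %/ e j).+1.
  pose D j q : {poly 'F_2} := \poly_(s < e j) ((z j (q * e j + s)%N)%:R).
  have sD j q : (size (D j q) < size (a j))%N by rewrite sa ltnS size_poly.
  have [g hg] := choice (fun j => adic_digit_surj (c j) (a0 j) (sD j)).
  have [f0 hf0] := @chinese_poly _ (fun j => a j ^+ c j) g n
    (fun i j ij => coprimep_expl _ (coprimep_expr _ (coprimep_sylvester _ ij))).
  pose A := \prod_(j < n) a j ^+ c j.
  have A0 : A != 0 by apply/prodf_neq0 => j _; rewrite expf_neq0.
  have sA : (size A <= m.+1)%N.
    suff -> : size A = (\sum_(j < n) c j * e j).+1.
      rewrite ltnS; apply: leq_trans dm; rewrite -big_split/=.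
      by apply: leq_sum => j _; rewrite /c mulSn addnC leq_add2r leq_divM.
    rewrite /A; elim/big_ind2 : _ => [|p q r s|j _]; first by rewrite size_poly1.
      by move=> sq ss; rewrite size_mul -?size_poly_gt0 ?sq ?ss//= addnS.
    have := size_exp (a j) (c j); rewrite sa/= mulnC => <-.
    by rewrite prednK// size_poly_gt0 expf_neq0.
  (* Reduction modulo the product of all moduli keeps every congruence and brings the degree below
     [m]. *)
  pose f := f0 %% A.
  have sf : (size f <= m)%N by rewrite -ltnS (leq_trans _ sA)// ltn_modp.
  exists (poly_rV f) => j i jn ij; rewrite /B poly_rV_K//.
  have iq : (i %/ e j < c j)%N by rewrite /c ltnS leq_div2r// ltnW.
  have -> : f = g j + (f - g j) by rewrite addrC subrK.
  rewrite adic_digitD hg// (@adic_digit_dvd _ _ _ _ (c j))//.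
    rewrite addr0 coef_poly ltn_pmod// -divn_eq.
    by case: (z j i).
  rewrite (_ : f - g j = (f0 - g j) - f0 %/ A * A); last first.
    by rewrite {1}(divp_eq f0 A) -/f; ring.
  rewrite dvdp_sub ?hf0// dvdp_mull//.
  by rewrite /A (bigD1 (Ordinal jn))//= dvdp_mulr.
(* The base of coordinate 0 is ['X], so its digits are the coefficients of the polynomial. *)
- apply: (can_inj (@rVpolyK _ _)); apply/polyP => i.
  have [mi|im] := leqP m i.
    by rewrite !nth_default// (leq_trans (size_poly _ _)).
  have digX (h : {poly 'F_2}) q : (adic_digit (a 0) h q)`_0 = h`_q.
    rewrite /adic_digit /a/=; elim: q h => [|q IHq] h.
      by rewrite [in RHS](divp_eq h 'X) coefD coefMX add0r.
    rewrite iterSr IHq [in RHS](divp_eq h 'X) coefD coefMX/=.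
    rewrite [X in _ + X]nth_default ?addr0//.
    by have := @ltn_modp _ h 'X; rewrite polyX_eq0 size_polyX ltnS; case: size => [|[|]].
  have e1 : e 0 = 1%N by rewrite /e size_polyX.
  have := pp' i im; rewrite /B e1 divn1 modn1 !digX.
  by move: (_`_i) (_`_i) => [[|[|//]] ?] [[|[|//]] ?]; rewrite -!val_eqE//= => _; exact/val_inj.
Qed.

(** * Shifted nets *)

Section agreement.
Context (V : finType) (n : nat) (beta : V -> 'I_n -> nat -> bool).
Implicit Types (d : 'I_n -> nat) (j : 'I_n).

(** Membership in the dyadic box of depths [d] around the corner. [V] is instantiated both by the
    net points for a fixed shift and by the shifts for a fixed point. *)
Definition agree d v := [forall j, all (beta v j) (iota 0 (d j))].

Lemma agreeP d v : reflect (forall j i, (i < d j)%N -> beta v j i) (agree d v).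
Proof.
apply: (iffP forallP) => [h j i ij|h j].
  by apply: (allP (h j)); rewrite mem_iota.
by apply/allP => i; rewrite mem_iota add0n; exact: h.
Qed.

Definition flippable d j i := exists sigma : V -> V,
  [/\ involutive sigma, forall v, beta (sigma v) j i = ~~ beta v j i &
      forall v j' i', (i' < d j')%N -> (j', i') != (j, i) ->
        beta (sigma v) j' i' = beta v j' i'].

(** Each further bit of depth halves the count, since an involution toggling that bit exchanges the
    two halves. [good] is a downward closed class of depths for which such involutions exist. *)
Lemma card_agree (good : ('I_n -> nat) -> Prop) d :
  (forall d d', good d -> (forall j, (d' j <= d j)%N) -> good d') ->
  (forall d j, good d -> (0 < d j)%N -> flippable d j (d j).-1) ->
  good d -> (#|[pred v | agree d v]| * 2 ^ (\sum_j d j) = #|V|)%N.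
Proof.
move=> good_le good_flip; move: {2}(\sum_j d j)%N (erefl (\sum_j d j)%N) => s.
elim: s d => [|s IHs] d ds gd.
  rewrite ds muln1; apply: eq_card => v; rewrite !inE; apply/agreeP => j i.
  have /eqP := ds; rewrite sum_nat_eq0 => /forallP/(_ j)/eqP -> //.
have [j dj] : exists j, (0 < d j)%N.
  apply/existsP; apply: contra_eqT ds; rewrite negb_exists => /forallP h.
  by rewrite big1// => j _; apply/eqP; rewrite -leqn0 leqNgt h.
pose d' i := (d i - (i == j))%N.
have d'd i : (d' i <= d i)%N by rewrite leq_subr.
have d's : (\sum_i d' i = s)%N.
  apply: succn_inj; rewrite -ds (bigD1 j)//= [in RHS](bigD1 j)//= /d' eqxx subn1.
  rewrite -addSn prednK//; congr addn; apply: eq_bigr => i /negPf ->.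
  by rewrite subn0.
rewrite -(IHs d' d's (good_le _ _ gd d'd)) ds d's expnS mulnCA mulnA; congr muln.
have [sigma [sigmaK sneg sinv]] := good_flip _ _ gd dj.
pose b v := beta v j (d j).-1.
have agreeE v : agree d v = agree d' v && b v.
  apply/agreeP/andP => [h|[/agreeP h bv] j' i].
    split; last by apply: h; rewrite prednK.
    by apply/agreeP => j' i /leq_trans/(_ (d'd _)); exact: h.
  have [ii' ij|] := ltnP i (d' j'); first exact: h.
  rewrite /d'; case: eqVneq => [->|_] ii ij; last by move: ii ij; lia.
  by rewrite (_ : i = (d j).-1)//; move: ii ij dj; lia.
have d'neq j' i : (i < d' j')%N -> (j', i) != (j, (d j).-1).
  rewrite /d' xpair_eqE negb_and; case: eqVneq => [->|//]; move: dj; lia.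
have agree_sigma v : agree d' (sigma v) = agree d' v.
  by apply/agreeP/agreeP => h j' i ij; have := h _ _ ij;
    rewrite sinv// ?d'neq//; exact: leq_trans (d'd _).
have -> : #|[pred v | agree d' v]| = (#|[pred v | agree d v]| +
    #|[pred v | agree d' v && ~~ b v]|)%N.
  rewrite -(cardID [pred v | b v] [pred v | agree d' v]); congr addn.
    by apply: eq_card => v; rewrite !inE agreeE.
  by apply: eq_card => v; rewrite !inE andbC.
rewrite mul2n -addnn; congr addn.
rewrite -[LHS](fintype.card_image (inv_inj sigmaK)); apply: eq_card => v.
rewrite !inE -{1}(sigmaK v) fintype.mem_image; last exact: inv_inj.
by rewrite inE agreeE agree_sigma /b sneg.
Qed.

Lemma haar_prod_le (R : realFieldType) (r : 'I_n -> nat) v :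
  `|\prod_j haar R (r j) (beta v j)| <= (agree (fun j => (r j).-1) v)%:R.
Proof.
have [ag|] := boolP (agree _ v).
  rewrite normr_prod; apply: prodr_ile1 => j _; rewrite normr_ge0/=.
  by apply: le_trans (haar_agree _ _ _) _; rewrite lern1 leq_b1.
rewrite negb_forall => /existsP[j nj].
rewrite (bigD1 j)//= normrM.
have := haar_agree R (r j) (beta v j); rewrite (negPf nj) normr_le0 => /eqP ->.
by rewrite normr0 mul0r.
Qed.

(** Toggling the finest bit read by factor [j] negates the product, so the terms cancel in pairs. *)
Lemma sum_haar_eq0 (R : realFieldType) (r : 'I_n -> nat) j :
  (0 < r j)%N -> flippable r j (r j).-1 ->
  \sum_v \prod_j haar R (r j) (beta v j) = 0.
Proof.
move=> rj [sigma [sigmaK sneg sinv]]; set S := LHS.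
suff : S = - S by move=> /eqP; rewrite -addr_eq0 -mulr2n mulrn_eq0 => /eqP.
rewrite {1}/S (reindex_inj (inv_inj sigmaK))/= /S -sumrN; apply: eq_bigr => v _.
rewrite (bigD1 j)//= [in RHS](bigD1 j)//= -mulNr; congr (_ * _).
  rewrite -(prednK rj); apply: haar_neg => [|k kr]; first exact: sneg.
  apply: sinv; first by rewrite (leq_trans kr)// leq_pred.
  by rewrite xpair_eqE eqxx/= ltn_eqF.
apply: eq_bigr => j' jj'; apply: (@haar_flip _ _ (r j')) => // k kr.
by apply: sinv => //; rewrite xpair_eqE (negPf jj').
Qed.

End agreement.

(** Greedy filling from the first coordinate. It serves to enlarge a box that is too fine for the
    net to one of admissible total depth. *)
Lemma exists_depth_sum n (d : 'I_n -> nat) s : (s <= \sum_j d j)%N ->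
  exists d' : 'I_n -> nat, (forall j, d' j <= d j)%N /\ (\sum_j d' j = s)%N.
Proof.
elim: n d s => [|n IHn] d s.
  by rewrite big_ord0 leqn0 => /eqP ->; exists d; rewrite big_ord0.
rewrite big_ord_recl => ds.
have [|d' [d'd d's]] := IHn (fun j => d (lift ord0 j)) (s - minn s (d ord0))%N.
  by move: ds; move: (d ord0) (\sum_(i < n) _)%N => x y; lia.
exists (fun j => if unlift ord0 j is Some i then d' i else minn s (d ord0)); split.
  by move=> j; case: unliftP => [i|] ->; rewrite ?geq_minr.
rewrite big_ord_recl unlift_none.
under eq_bigr do rewrite liftK.
by rewrite d's subnKC// geq_minl.
Qed.

Lemma geometric_sum_le (R : realFieldType) (q S : nat) :
  \sum_(s < S) (1 - (4 * q.+1%:R)^-1) ^+ s <= 4 * q.+1%:R :> R.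
Proof.
set c : R := 1 - _.
have q0 : 0 < 4 * q.+1%:R :> R by rewrite mulr_gt0.
have c0 : 0 <= c by rewrite subr_ge0 invf_le1// -natrM ler1n.
have := subrXX 1 c S; rewrite expr1n.
under eq_bigr do rewrite expr1n mul1r.
rewrite (_ : 1 - c = (4 * q.+1%:R)^-1); last by rewrite /c; ring.
move=> h; rewrite -[leRHS]mulr1 mulrC -ler_pdivrMr// mulrC -h.
by rewrite gerBl exprn_ge0.
Qed.

(** Bernoulli's inequality. It replaces the root [2 ^ (- s / (2 (q + 1)))] by the [s]-th power of a
    rational ratio whose geometric sum is at most [4 (q + 1)]. *)
Lemma half_le_geometric (R : realFieldType) (q : nat) :
  2^-1 <= (1 - (4 * q.+1%:R)^-1) ^+ 2 ^+ q.+1 :> R.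
Proof.
have q0 : 0 < 4 * q.+1%:R :> R by rewrite mulr_gt0.
have bern (x : R) k : 0 <= x <= 1 -> 1 - k%:R * x <= (1 - x) ^+ k.
  move=> /andP[x0 x1]; elim: k => [|k IHk]; first by rewrite mul0r subr0 expr0.
  have := ler_wpM2l (_ : 0 <= 1 - x) IHk; rewrite subr_ge0 => /(_ x1).
  rewrite exprS -(natr1 k); apply: le_trans.
  have : 0 <= k%:R * x * x by rewrite !mulr_ge0.
  move: (k%:R : R) => K; nra.
rewrite -exprM; apply: le_trans (bern _ _ _).
  rewrite natrM invfM (_ : 2 * q.+1%:R * _ = 2^-1); first lra.
  have : q.+1%:R != 0 :> R by rewrite pnatr_eq0.
  by move: (q.+1%:R : R) => x x0; field.
by rewrite invr_ge0 ltW//= invf_le1// -natrM ler1n.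
Qed.

Definition net_shift (n m : nat) := {ffun 'I_n.+1 * 'I_m.+1 -> bool}.

Section shifted_net.
Context (R : rcfType) (n m t : nat).
Variable B : 'rV['F_2]_m.+1 -> nat -> nat -> bool.
Hypothesis B_add : forall p w j i, B (p + w) j i = B p j i (+) B w j i.
Hypothesis B_surj : forall d : nat -> nat, (\sum_(j < n.+1) d j + t <= m.+1)%N ->
  forall z : nat -> nat -> bool, exists p,
    forall j i, (j < n.+1)%N -> (i < d j)%N -> B p j i = z j i.

Local Notation shift := (net_shift n m).
Local Notation levels := {ffun 'I_n.+1 -> 'I_m.+2}.

Definition shifted (T : shift) (p : 'rV['F_2]_m.+1) (j : 'I_n.+1) (i : nat) : bool :=
  B p j i (+) T (j, inord i).

(** Discrepancy at the resolution of the net: the box consists of all cells up to and including that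
    of [a], hence the [.+1] in its side lengths. *)
Definition net_discrepancy (a : 'I_n.+1 -> nat -> bool) (T : shift) : R :=
  \sum_p \prod_j (bits_num m.+1 (shifted T p j) <= bits_num m.+1 (a j))%:R -
  2 ^+ m.+1 * \prod_j ((bits_num m.+1 (a j)).+1%:R / 2 ^+ m.+1).

Section fixed_corner.
Variable a : 'I_n.+1 -> nat -> bool.

Let beta (T : shift) p j i := shifted T p j i == a j i.
(** The same pattern with the shift as varying index, so that [card_agree] can count shifts. *)
Let betaT p (T : shift) j i := shifted T p j i == a j i.

Let flip (j : 'I_n.+1) (i : nat) (T : shift) : shift :=
  [ffun x => T x (+) (x == (j, inord i))].

Let flipK j i : involutive (flip j i).
Proof. by move=> T; apply/ffunP => x; rewrite !ffunE -addbA addbb addbF. Qed.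

Let beta_flip T p (j j' : 'I_n.+1) i i' : (i < m.+1)%N -> (i' < m.+1)%N ->
  beta (flip j i T) p j' i' = beta T p j' i' (+) ((j', i') == (j, i)).
Proof.
move=> im i'm; rewrite /beta /shifted ffunE !xpair_eqE.
have -> : (inord i' == inord i :> 'I_m.+1) = (i' == i) by rewrite -val_eqE/= !inordK.
by case: (B p j' i'); case: (T _); case: (a j' i'); case: (_ && _).
Qed.

(** The surjectivity of the bits gives a [w] whose only nonzero bit within depth [d] is the one to
    toggle. Translation by [w] is the flip, and it is an involution in characteristic 2. *)
Let net_flippable T (d : 'I_n.+1 -> nat) j : (\sum_j d j + t <= m.+1)%N ->
  (0 < d j)%N -> flippable (beta T) d j (d j).-1.
Proof.
move=> dm dj.
have [|w hw] := @B_surj (fun k => d (inord k)) _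
    (fun k i => (k == j) && (i == (d j).-1)).
  by under eq_bigr do rewrite inord_val.
have wE (j' : 'I_n.+1) i' : (i' < d j')%N -> B w j' i' = ((j', i') == (j, (d j).-1)).
  by move=> ij; rewrite hw ?inord_val// xpair_eqE val_eqE.
exists (fun p => p + w); split => [p|p|p j' i' ij nij].
- rewrite -addrA (_ : w + w = 0) ?addr0//; apply/rowP => k.
  by rewrite !mxE addrr_pchar2// pchar_Fp.
- rewrite /beta /shifted B_add wE ?prednK// eqxx.
  by case: (B p j _); case: (T _); case: (a j _).
- by rewrite /beta /shifted B_add wE// (negPf nij) addbF.
Qed.

Let card_net_agree T d : (\sum_j d j + t <= m.+1)%N ->
  (#|[pred p | agree (beta T) d p]| * 2 ^ (\sum_j d j) = 2 ^ m.+1)%N.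
Proof.
move=> dm.
rewrite (card_agree (good := fun d => (\sum_j d j + t <= m.+1)%N))//.
- by rewrite card_mx card_Fp// mul1n.
- by move=> d1 d2 h h'; apply: leq_trans h; rewrite leq_add2r leq_sum.
- by move=> d1 j; exact: net_flippable.
Qed.

(** The box is enlarged to total depth at most [m.+1 - t], where the count is exact. If [t] exceeds
    [m.+1], the number of all points is already small enough. *)
Let card_net_agree_le T d : (m.+1 <= \sum_j d j + t + n.+1)%N ->
  (#|[pred p | agree (beta T) d p]| <= 2 ^ (t + n.+1))%N.
Proof.
move=> dm.
have [d' [d'd d's]] := exists_depth_sum (geq_minr (m.+1 - t) (\sum_j d j)).
have [tm|mt] := leqP t m.+1; last first.
  apply: leq_trans (max_card _) _; rewrite card_mx card_Fp// mul1n leq_exp2l//.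
  by move: mt; lia.
have := @card_net_agree T d'; rewrite d's => h.
have {}h : (#|[pred p | agree (beta T) d p]| * 2 ^ minn (m.+1 - t) (\sum_j d j)
    <= 2 ^ m.+1)%N.
  rewrite -h; last by rewrite addnC -leq_subRL// geq_minl.
  rewrite leq_mul2r; apply/orP; right; apply: subset_leq_card.
  apply/fintype.subsetP => p; rewrite !inE => /agreeP ag; apply/agreeP => j i ij.
  by apply: ag; exact: leq_trans (d'd j).
rewrite -(leq_pmul2r (expn_gt0 2 (minn (m.+1 - t) (\sum_j d j)))).
apply: leq_trans h _; rewrite -expnD leq_exp2l//.
by move: dm tm; move: (\sum_j _)%N => x; lia.
Qed.

Let card_shift_agree p d : (forall j, d j <= m.+1)%N ->
  (#|[pred T | agree (betaT p) d T]| * 2 ^ (\sum_j d j) = #|{: shift}|)%N.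
Proof.
move=> dm; apply: (card_agree (good := fun d => forall j, d j <= m.+1)%N) => //.
- by move=> d1 d2 h h' j; exact: leq_trans (h j).
- move=> d1 j h dj; exists (flip j (d1 j).-1).
  have dm1 : ((d1 j).-1 < m.+1)%N by rewrite prednK.
  split; first exact: flipK.
    by move=> T; rewrite [LHS]beta_flip// eqxx addbT.
  move=> T j' i' ij nij; rewrite [LHS]beta_flip ?(negPf nij) ?addbF//.
  exact: leq_trans (h j').
Qed.

Variable c : 'I_n.+1 -> nat -> R.
Hypothesis c_le1 : forall j r, `|c j r| <= 1.
Hypothesis c0E : forall j, c j 0 = (bits_num m.+1 (a j)).+1%:R / 2 ^+ m.+1.
Hypothesis cE : forall j u, (bits_num m.+1 u <= bits_num m.+1 (a j))%:R =
  \sum_(r < m.+2) c j r * haar R r (fun i => u i == a j i).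

Let X (r : levels) (T : shift) : R :=
  \prod_j c j (r j) * \sum_p \prod_j haar R (r j) (beta T p j).

(** Truncated subtraction: if [t] exceeds [m.+1] this is 0, and no nonzero level is claimed to
    vanish. *)
Let M0 := (m.+1 - t)%N.

Let X_eq0 (r : levels) T : (0 < \sum_j r j <= M0)%N -> X r T = 0.
Proof.
move=> /andP[r0 rM].
have /existsP[j rj] : [exists j, (0 < r j)%N].
  apply: contraTT r0; rewrite negb_exists -leqNgt leqn0 sum_nat_eq0 => /forallP h.
  by apply/forallP => j; rewrite /= -leqn0 leqNgt h.
have S0 := @sum_haar_eq0 _ _ (beta T) R (fun j => nat_of_ord (r j)) j rj.
rewrite /X S0 ?mulr0//; apply: net_flippable => //.
by move: r0 rM; rewrite /M0; move: (\sum_j _)%N => x; lia.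
Qed.

(** Expanding the product gives one term per level vector. The zero vector yields exactly the volume
    term, which cancels; the levels of total at most [M0] vanish; the others are grouped by
    total. *)
Let net_discrepancyE T : net_discrepancy a T =
  \sum_(s < (n.+1 * m.+1).+1) \sum_(r : levels | (\sum_j r j == M0 + s.+1)%N) X r T.
Proof.
transitivity (\sum_(r : levels | (M0 < \sum_j r j)%N) X r T); last first.
  have rle (r : levels) : (\sum_j r j <= n.+1 * m.+1)%N.
    apply: (@leq_trans (\sum_(j < n.+1) m.+1)%N).
      by apply: leq_sum => j _; rewrite -ltnS ltn_ord.
    by rewrite sum_nat_const card_ord.
  rewrite (partition_big (fun r : levels =>
    inord (\sum_j r j - M0.+1) : 'I_(n.+1 * m.+1).+1) xpredT)//=.
  apply: eq_bigr => s _; apply: eq_bigl => r.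
  rewrite -val_eqE/= inordK; last by rewrite ltnS (leq_trans (leq_subr _ _)).
  by move: (\sum_j r j)%N => x; case: s => s hs /=; lia.
transitivity (\sum_(r : levels | (0 < \sum_j r j)%N) X r T); last first.
  rewrite (bigID (fun r : levels => (M0 < \sum_j r j)%N))/=.
  rewrite [X in _ + X]big1 ?addr0.
    by apply: eq_bigl => r; move: (\sum_j r j)%N => x; lia.
  by move=> r /andP[h1 h2]; apply: X_eq0; rewrite h1 leqNgt.
have allE : \sum_p \prod_j (bits_num m.+1 (shifted T p j) <= bits_num m.+1 (a j))%:R
    = \sum_r X r T.
  transitivity (\sum_p \sum_(r : levels)
      \prod_j c j (r j) * \prod_j haar R (r j) (beta T p j)).
    apply: eq_bigr => p _; under eq_bigr do rewrite cE.
    rewrite bigA_distr_bigA/=; apply: eq_bigr => r _.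
    by rewrite -big_split.
  by rewrite exchange_big/=; apply: eq_bigr => r _; rewrite -mulr_sumr.
rewrite /net_discrepancy allE (bigD1 [ffun=> ord0])//=.
rewrite (_ : X _ _ = 2 ^+ m.+1 * \prod_j ((bits_num m.+1 (a j)).+1%:R / 2 ^+ m.+1)).
  rewrite addrAC subrr add0r; apply: eq_bigl => r; rewrite lt0n; congr (~~ _).
  rewrite sum_nat_eq0; apply/eqP/forallP => [-> j|r0]; first by rewrite ffunE.
  by apply/ffunP => j; rewrite ffunE; apply/val_inj/eqP; exact: r0.
rewrite /X mulrC; congr (_ * _); last by apply: eq_bigr => j _; rewrite ffunE c0E.
rewrite (eq_bigr (fun=> 1)) => [|p _]; last by rewrite big1// => j _; rewrite ffunE.
by rewrite sumr_const card_mx card_Fp// mul1n natrX.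
Qed.

(** [X r T] is at most the number of net points in a dyadic box, itself at most [2 ^ (t + n.+1)].
    Summing that number over [T] and exchanging the sums, each point lies in the box for a
    proportion [2 ^ (- \sum_j d j)] of the shifts. *)
Let X_moment q (r : levels) : (M0 < \sum_j r j)%N ->
  \sum_T X r T ^+ 2 ^+ q.+1 <=
    ((2 ^+ (t + n.+1)) ^+ 2) ^+ q.+1 *
    (2 ^+ (m.+1 + n.+1) * #|{: shift}|%:R / 2 ^+ (\sum_j r j)).
Proof.
move=> rM; pose d (j : 'I_n.+1) := (r j).-1.
pose cnt T := #|[pred p | agree (beta T) d p]|.
have rd : (\sum_j r j <= \sum_j d j + n.+1)%N.
  rewrite -[X in (_ + X)%N]card_ord -sum1_card -big_split/=.
  by apply: leq_sum => j _; rewrite /d addn1 leqSpred.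
have XT T : `|X r T| <= (cnt T)%:R.
  rewrite /X normrM -[leRHS]mul1r ler_pM//.
    by rewrite normr_prod; apply: prodr_ile1 => j _; rewrite normr_ge0 c_le1.
  apply: le_trans (ler_norm_sum _ _ _) _.
  rewrite /cnt -sum1_card natr_sum [leRHS]big_mkcond/=; apply: ler_sum => p _.
  apply: le_trans (haar_prod_le _ R (fun j => nat_of_ord (r j)) p) _.
  by rewrite inE -/d; case: (agree _ _ _).
have cntK T : (cnt T)%:R <= 2 ^+ (t + n.+1) :> R.
  rewrite -natrX ler_nat; apply: card_net_agree_le.
  by move: rM rd; rewrite /M0; move: (\sum_j _)%N (\sum_j _)%N => x y; lia.
have XK T : X r T ^+ 2 ^+ q.+1 <= ((2 ^+ (t + n.+1)) ^+ 2) ^+ q.+1 * (cnt T)%:R.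
  rewrite -real_normK ?num_real//.
  (* The count is an integer: either it vanishes together with [X], or it is at least 1 and may be
     inserted as a factor. *)
  have [c0|c0] := posnP (cnt T).
    by move: (XT T); rewrite c0 normr_le0 => /eqP ->; rewrite normr0 !expr0n mulr0.
  rewrite -[leLHS]mulr1 ler_pM ?exprn_ge0//; last by rewrite ler1n.
  by rewrite !lerXn2r ?nnegrE ?exprn_ge0// (le_trans (XT T)).
apply: le_trans (ler_sum _ (fun T _ => XK T)) _.
rewrite -mulr_sumr ler_wpM2l ?exprn_ge0// -natr_sum.
have -> : (\sum_T cnt T = \sum_p #|[pred T | agree (betaT p) d T]|)%N.
  rewrite /cnt; under eq_bigr do rewrite -sum1_card big_mkcond.
  rewrite exchange_big/=; apply: eq_bigr => p _.
  by rewrite -sum1_card [RHS]big_mkcond.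
rewrite ler_pdivlMr ?exprn_gt0// -!natrX -!natrM ler_nat.
apply: (@leq_trans ((\sum_p #|[pred T | agree (betaT p) d T]|) * 2 ^ (\sum_j d j + n.+1))%N).
  by rewrite leq_mul2l leq_exp2l// rd orbT.
rewrite expnD mulnA big_distrl/=.
rewrite (eq_bigr (fun=> #|{: shift}|)) => [|p _]; last first.
  by rewrite card_shift_agree// => j; rewrite /d; have := ltn_ord (r j); lia.
by rewrite sum_nat_const card_mx card_Fp// mul1n expnD mulnAC.
Qed.

(** Level [r j] reads the bits below [r j], so the finest one is number [(r j).-1]; toggling it in
    the shift negates factor [j] for all points at once. *)
Let X_flip_neg (r : levels) (j : 'I_n.+1) T : (0 < r j)%N ->
  X r (flip j (r j).-1 T) = - X r T.
Proof.
move=> rj; rewrite /X -mulrN -sumrN; congr (_ * _); apply: eq_bigr => p _.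
have rm := ltn_ord (r j).
rewrite (bigD1 j)//= [in RHS](bigD1 j)//= -mulNr; congr (_ * _).
  rewrite -{1 3}(prednK rj); apply: haar_neg => [|k kr].
    by rewrite beta_flip ?eqxx ?addbT//; move: rj rm; lia.
  by rewrite beta_flip ?xpair_eqE ?(ltn_eqF kr) ?andbF ?addbF//; move: kr rj rm; lia.
apply: eq_bigr => j' jj'; apply: (@haar_flip _ _ (r j')) => // k kr.
rewrite beta_flip ?xpair_eqE ?(negPf jj') ?addbF//.
  by move: rj rm; lia.
by have := ltn_ord (r j'); move: kr; lia.
Qed.

Let X_flip_inv (r : levels) (j : 'I_n.+1) v T : (r j < v <= m.+1)%N ->
  X r (flip j v.-1 T) = X r T.
Proof.
move=> /andP[rv vm]; rewrite /X; congr (_ * _); apply: eq_bigr => p _.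
apply: eq_bigr => j' _; apply: (@haar_flip _ _ (r j')) => // k kr.
have rm := ltn_ord (r j').
rewrite beta_flip; [|by move: rv vm; lia|by move: rm kr; lia].
rewrite xpair_eqE; case: eqVneq => [jj'|_]; last by rewrite addbF.
by rewrite (_ : k == v.-1 = false) ?addbF//; move: rv kr; rewrite jj'; lia.
Qed.

(** For each excess [s] the iterated estimate gives a norm decaying like [cc ^+ s]. Minkowski over
    [s] then sums a geometric series, at the cost of [4 * q.+1] in the norm. *)
Lemma net_discrepancy_moment_corner q :
  \sum_T net_discrepancy a T ^+ 2 ^+ q.+1 <=
  (16 * 4 ^+ n * 2 ^+ (t + n.+1) ^+ 3 * q.+1%:R ^+ n.+2 * m.+2%:R ^+ n) ^+ q.+1 *
  #|{: shift}|%:R.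
Proof.
pose K : R := 2 ^+ (t + n.+1).
pose W : R := K * #|{: shift}|%:R.
pose G : R := (4 * q.+1%:R * m.+2%:R) ^+ n.
pose cc : R := 1 - (4 * q.+1%:R)^-1.
pose F s T := \sum_(r : levels | (\sum_j r j == M0 + s.+1)%N) X r T.
have K1 : 1 <= K by rewrite exprn_ege1// ler1n.
have W0 : 0 <= W by rewrite mulr_ge0// (le_trans ler01).
have G0 : 0 <= G by rewrite exprn_ge0// !mulr_ge0.
have cc0 : 0 <= cc by rewrite subr_ge0 invf_le1 -?natrM ?ltr0n// ler1n.
have GK0 : 0 <= G * K ^+ 2 by rewrite mulr_ge0// exprn_ge0// (le_trans ler01).
(* The iterated estimate bounds the norm of the square, whereas Minkowski over [s] needs that of the
   function itself. *)
pose A0 : R := Num.sqrt (G * K ^+ 2).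
have A0E : A0 ^+ 2 = G * K ^+ 2 by rewrite sqr_sqrtr.
have A00 : 0 <= A0 by exact: sqrtr_ge0.
have evenX (x : R) : x ^+ (q.*2.+1).+1 = x ^+ 2 ^+ q.+1.
  by rewrite -exprM mul2n doubleS.
have F_moment s : \sum_T `|F s T| ^+ (q.*2.+1).+1 <= (A0 * cc ^+ s) ^+ (q.*2.+1).+1 * W.
  under eq_bigr do rewrite evenX real_normK ?num_real//.
  pose WL : R := 2 ^+ (m.+1 + n.+1) * #|{: shift}|%:R / 2 ^+ (M0 + s.+1).
  have K20 : 0 <= K ^+ 2 by rewrite exprn_ge0// (le_trans ler01).
  have WL0 : 0 <= WL by rewrite divr_ge0 ?mulr_ge0 ?exprn_ge0.
  apply: le_trans (@iterated_moment R shift n m.+1 q X (fun j v => flip j v.-1)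
    (fun j v => flipK j v.-1) (fun r j T h => X_flip_neg T h)
    (fun r j v T h => X_flip_inv T h) (M0 + s.+1)%N (K ^+ 2) WL K20 WL0 _) _.
    by move=> r rL; rewrite /WL -rL; apply: X_moment; rewrite rL addnS ltnS leq_addr.
  rewrite evenX (exprMn _ A0) A0E (exprMn _ (G * _)) -[leRHS]mulrA ler_wpM2l ?exprn_ge0//.
  (* This uses [m.+1 <= t + M0]; the lost powers of 2 form the factor [K] in [W]. *)
  apply: (@le_trans _ _ (2^-1 ^+ s * W)).
    rewrite /WL ler_pdivrMr ?exprn_gt0// /W /K exprVn.
    rewrite [leRHS](_ : _ = 2 ^+ (t + n.+1 + M0.+1) * #|{: shift}|%:R).
      rewrite ler_wpM2r// ler_eXn2l ?ltr1n// /M0; lia.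
    rewrite -(addSnnS M0) (exprD _ M0.+1) (exprD _ (t + n.+1)).
    have : 2 ^+ s != 0 :> R by rewrite expf_neq0// pnatr_eq0.
    move: (2 ^+ s) (2 ^+ M0.+1) (2 ^+ (t + n.+1)) => x y z x0.
    by field.
  rewrite ler_wpM2r//.
  rewrite (exprAC cc) (exprAC (cc ^+ 2)) lerXn2r ?nnegrE ?invr_ge0 ?exprn_ge0//.
  exact: half_le_geometric.
have sumF T : net_discrepancy a T ^+ 2 ^+ q.+1 <=
    (\sum_(s < (n.+1 * m.+1).+1) `|F s T|) ^+ (q.*2.+1).+1.
  rewrite evenX net_discrepancyE; set x := \sum_(s < _) _; set y := \sum_(s < _) _.
  have xy : `|x| <= y by exact: ler_norm_sum.
  by rewrite -real_normK ?num_real// !lerXn2r ?nnegrE ?exprn_ge0// (le_trans _ xy).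
apply: le_trans (ler_sum _ (fun T _ => sumF T)) _.
apply: le_trans (minkowski_sum _ _ (fun s _ => F_moment s)) _ => [//|s|].
  by rewrite mulr_ge0// exprn_ge0.
rewrite -mulr_sumr evenX.
apply: (@le_trans _ _ ((A0 * (4 * q.+1%:R)) ^+ 2 ^+ q.+1 * W)).
  have S0 : 0 <= \sum_(s < (n.+1 * m.+1).+1) cc ^+ s.
    by apply: sumr_ge0 => s _; rewrite exprn_ge0.
  rewrite ler_wpM2r//.
  rewrite !lerXn2r ?nnegrE ?exprn_ge0 ?mulr_ge0//.
  by rewrite ler_wpM2l// geometric_sum_le.
rewrite (exprMn _ A0) A0E /W mulrA ler_wpM2r//.
(* Since [K] is at least 1, its single occurrence in [W] is absorbed into the power, whence the cube
   of [K] in the bound. *)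
apply: (@le_trans _ _ ((G * K ^+ 2 * (4 * q.+1%:R) ^+ 2) ^+ q.+1 * K ^+ q.+1)).
  rewrite ler_wpM2l ?exprn_ge0 ?mulr_ge0// ?exprn_ge0// ?mulr_ge0//.
  by rewrite ler_eXnr.
rewrite -exprMn le_eqVlt; apply/orP; left; apply/eqP; congr (_ ^+ _).
rewrite /G -/K !exprMn (exprS _ n.+1) (exprS _ n).
by ring.
Qed.

End fixed_corner.

Lemma net_discrepancy_moment a q :
  \sum_T net_discrepancy a T ^+ 2 ^+ q.+1 <=
  (16 * 4 ^+ n * 2 ^+ (t + n.+1) ^+ 3 * q.+1%:R ^+ n.+2 * m.+2%:R ^+ n) ^+ q.+1 *
  #|{: shift}|%:R.
Proof.
have [c hc] := choice (fun j => haar_expansion R m.+1 (a j)).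
apply: (@net_discrepancy_moment_corner a c) => j; by have [] := hc j.
Qed.

End shifted_net.

(** * Exponential moments *)

(* The term with q.+1 = floor w alone dominates expR w. *)
Lemma expR_le_moments (R : realType) (Q L : nat) (w : R) :
  (2 <= Q)%N -> 0 <= w -> w <= L%:R ->
  expR w <= expR 1 + \sum_(q < L) (expR 1 * w / q.+1%:R) ^+ (Q * q.+1).
Proof.
move=> Q2 w0 wL.
have term0 (q : 'I_L) : 0 <= (expR 1 * w / q.+1%:R) ^+ (Q * q.+1).
  by rewrite exprn_ge0// divr_ge0// mulr_ge0// expR_ge0.
have [w1|w1] := leP w 1.
  by rewrite (le_trans (_ : _ <= expR 1)) ?ler_expR// lerDl sumr_ge0.
have /andP[kw wk] := truncn_itv w0.
have : (0 < Num.truncn w)%N by rewrite truncn_gt0 ltW.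
move: kw wk; case: (Num.truncn w) => // k kw wk _.
have kL : (k < L)%N by rewrite -(@ltr_nat R) (lt_le_trans _ wL)// (lt_le_trans _ kw)// ltr_nat.
rewrite (le_trans (_ : _ <= (expR 1 * w / k.+1%:R) ^+ (Q * k.+1)))//; last first.
  rewrite (bigD1 (Ordinal kL))//= addrCA lerDl addr_ge0 ?expR_ge0//.
  by apply: sumr_ge0 => i _; exact: term0.
have e1 : 1 <= expR 1 :> R by rewrite -[leLHS]expR0 ler_expR.
apply: (@le_trans _ _ (expR 1 ^+ (2 * k.+1))).
  rewrite -expRM_natl mulr1 ler_expR natrM.
  by move: wk; rewrite -(natr1 k.+1) -(natr1 k); have : 0 <= k%:R :> R by []; lra.
apply: (@le_trans _ _ (expR 1 ^+ (Q * k.+1))).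
  by rewrite ler_weXn2l// leq_mul2r Q2 orbT.
rewrite lerXn2r// ?nnegrE ?expR_ge0//.
  by rewrite divr_ge0// mulr_ge0// expR_ge0.
by rewrite -mulrA ler_peMr ?expR_ge0// ler_pdivlMr// mul1r.
Qed.

Lemma exprD_superadditive (R : realFieldType) (u v : R) q : 0 <= u -> 0 <= v ->
  u ^+ q.+1 + v ^+ q.+1 <= (u + v) ^+ q.+1.
Proof.
move=> u0 v0; elim: q => [//|q IHq].
rewrite 3!(exprS _ q.+1).
apply: (@le_trans _ _ ((u + v) * (u ^+ q.+1 + v ^+ q.+1))).
  have : 0 <= u * v ^+ q.+1 by rewrite mulr_ge0// exprn_ge0.
  have : 0 <= v * u ^+ q.+1 by rewrite mulr_ge0// exprn_ge0.
  by rewrite !mulrDr !mulrDl; lra.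
by rewrite ler_wpM2l// addr_ge0.
Qed.

Lemma sum_half_le1 (R : realFieldType) (L : nat) :
  \sum_(q < L) 2^-1 ^+ q.+1 <= 1 :> R.
Proof.
have := subrXX (1 : R) 2^-1 L; rewrite expr1n.
under eq_bigr do rewrite expr1n mul1r.
under [X in _ -> X <= _]eq_bigr do rewrite exprS.
rewrite -mulr_sumr; have : 0 <= 2^-1 ^+ L :> R by rewrite exprn_ge0// invr_ge0.
by lra.
Qed.

Lemma powR_moment (R : realType) (Q q : nat) (z : R) : (0 < Q)%N -> 0 <= z ->
  (z `^ (2 / Q%:R)) ^+ (Q * q) = z ^+ 2 ^+ q.
Proof.
move=> Q0 z0; rewrite exprM; congr (_ ^+ _).
rewrite -powR_mulrn ?powR_ge0// -powRrM divfK ?pnatr_eq0 -?lt0n//.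
by rewrite powR_mulrn.
Qed.

(** With [Q = n.+2] in [expR_le_moments], the powers of [w] are even moments of the discrepancy.
    Their growth [q.+1 ^ (n.+2 * q.+1)] is cancelled by the denominators there, leaving a geometric
    series. The summand [n.+1] leaves room for rounding the corner. *)
Lemma net_exp_moment (R : realType) (n t : nat) : exists2 Lam : R, 0 < Lam &
  forall (m : nat) (B : 'rV['F_2]_m.+1 -> nat -> nat -> bool),
  (forall p w j i, B (p + w) j i = B p j i (+) B w j i) ->
  (forall d : nat -> nat, (\sum_(j < n.+1) d j + t <= m.+1)%N ->
    forall z : nat -> nat -> bool, exists p,
      forall j i, (j < n.+1)%N -> (i < d j)%N -> B p j i = z j i) ->
  forall a : 'I_n.+1 -> nat -> bool,
  \sum_(T : net_shift n m) expR
    (((`|net_discrepancy R B a T| + n.+1%:R) / (Lam * Num.sqrt (m.+2%:R ^+ n)))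
     `^ (2 / n.+2%:R)) <= (expR 1 + 1) * #|{: net_shift n m}|%:R.
Proof.
(* The factor 4 comes from [(x + y) ^ (2 k) <= 4 ^ k * (x ^ (2 k) + y ^ (2 k))]. *)
pose K : R := 4 * (16 * 4 ^+ n * 2 ^+ (t + n.+1) ^+ 3 + n.+1%:R ^+ 2).
have K0 : 0 < K.
  by rewrite mulr_gt0// addr_gt0// ?exprn_gt0// !mulr_gt0// ?exprn_gt0.
pose e : R := expR 1.
have e0 : 0 < e := expR_gt0 1.
(* Chosen so that the term of index [q] is at most [2^-1 ^+ q.+1] per shift. *)
pose Lam := Num.sqrt (2 * e ^+ n.+2 * K).
have eK0 : 0 < 2 * e ^+ n.+2 * K.
  by apply: mulr_gt0 K0; apply: mulr_gt0 => //; exact: exprn_gt0.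
have Lam2 : Lam ^+ 2 = 2 * e ^+ n.+2 * K by rewrite sqr_sqrtr// ltW.
have Lam0 : 0 < Lam by rewrite sqrtr_gt0.
exists Lam => // m B Badd Bsurj a.
pose D T := `|net_discrepancy R B a T| + n.+1%:R.
have D0 T : 0 <= D T by rewrite addr_ge0.
have Dmom q : \sum_T D T ^+ 2 ^+ q.+1 <=
    (K * q.+1%:R ^+ n.+2 * m.+2%:R ^+ n) ^+ q.+1 * #|{: net_shift n m}|%:R.
  have ptw T : D T ^+ 2 ^+ q.+1 <=
      4 ^+ q.+1 * (net_discrepancy R B a T ^+ 2 ^+ q.+1 + n.+1%:R ^+ 2 ^+ q.+1).
    rewrite -[in leRHS]real_normK ?num_real// /D.
    move: `|_| (normr_ge0 (net_discrepancy R B a T)) (n.+1%:R : R) (ler0n R n.+1).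
    move=> x x0 y y0; rewrite mulrDr -!exprMn.
    have [xy|/ltW yx] := leP x y.
      rewrite -[leLHS]add0r lerD ?exprn_ge0 ?mulr_ge0 ?sqr_ge0//.
      rewrite lerXn2r ?nnegrE ?mulr_ge0 ?sqr_ge0//; nra.
    rewrite -[leLHS]addr0 lerD ?exprn_ge0 ?mulr_ge0 ?sqr_ge0//.
    rewrite lerXn2r ?nnegrE ?mulr_ge0 ?sqr_ge0//; nra.
  apply: le_trans (ler_sum _ (fun T _ => ptw T)) _.
  rewrite -mulr_sumr big_split/= sumr_const -[_ *+ #|_|]mulr_natr.
  apply: le_trans (ler_wpM2l (exprn_ge0 _ _) (lerD (net_discrepancy_moment R Badd Bsurj a q)
    (lexx _))) _ => //.
  rewrite -mulrDl mulrA ler_wpM2r//.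
  set C := 16 * _ * _; set u := q.+1%:R ^+ _; set v := m.+2%:R ^+ _.
  have u1 : 1 <= u by rewrite exprn_ege1// ler1n.
  have v1 : 1 <= v by rewrite exprn_ege1// ler1n.
  have u0 : 0 <= u by rewrite exprn_ge0.
  have v0 : 0 <= v by rewrite exprn_ge0.
  have C0 : 0 <= C by rewrite !mulr_ge0 ?exprn_ge0.
  rewrite (_ : K * u * v = 4 * ((C + n.+1%:R ^+ 2) * (u * v))); last by rewrite /K -/C; ring.
  rewrite [leRHS]exprMn ler_wpM2l ?exprn_ge0//.
  apply: (@le_trans _ _ ((C * u * v) ^+ q.+1 + (n.+1%:R ^+ 2 * (u * v)) ^+ q.+1)).
    have uv : n.+1%:R ^+ 2 <= n.+1%:R ^+ 2 * (u * v).
      by rewrite ler_peMr ?exprn_ge0// mulr_ege1.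
    by rewrite lerD2l; apply: lerXn2r; rewrite ?nnegrE// ?(le_trans _ uv)// exprn_ge0.
  rewrite (mulrDl C) (mulrA C); apply: exprD_superadditive.
    by apply: mulr_ge0 => //; apply: mulr_ge0.
  by apply: mulr_ge0; [exact: exprn_ge0 | exact: mulr_ge0].
pose M : R := m.+2%:R ^+ n.
have M0 : 0 < M by rewrite exprn_gt0.
pose Z T := D T / (Lam * Num.sqrt M).
have Z0 T : 0 <= Z T by rewrite divr_ge0// mulr_ge0 ?ltW// sqrtr_gt0.
pose w T := Z T `^ (2 / n.+2%:R).
have w0 T : 0 <= w T by exact: powR_ge0.
(* There are finitely many shifts, so one truncation [L] serves all of them; the final bound does
   not depend on it. *)
pose L := Num.bound (\sum_T w T).
have wL T : w T <= L%:R.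
  apply: (@le_trans _ _ (\sum_T w T)).
    by rewrite (bigD1 T)//= lerDl sumr_ge0.
  by rewrite ltW// archi_boundP// sumr_ge0.
apply: le_trans (ler_sum _ (fun T _ => @expR_le_moments _ n.+2 L (w T) _ (w0 T) (wL T))) _ => //.
rewrite big_split/= sumr_const -[_ *+ #|_|]mulr_natr mulrDl lerD2l exchange_big/=.
have term q : \sum_T (expR 1 * w T / q.+1%:R) ^+ (n.+2 * q.+1) <=
    2^-1 ^+ q.+1 * #|{: net_shift n m}|%:R.
  have -> : \sum_T (expR 1 * w T / q.+1%:R) ^+ (n.+2 * q.+1) =
      ((e / q.+1%:R) ^+ n.+2 / (Lam ^+ 2 * M)) ^+ q.+1 * \sum_T D T ^+ 2 ^+ q.+1.
    rewrite mulr_sumr; apply: eq_bigr => T _.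
    rewrite mulrAC exprMn powR_moment// exprM -!exprMn; congr (_ ^+ _).
    have -> : Z T ^+ 2 = D T ^+ 2 / (Lam ^+ 2 * M).
      by rewrite /Z expr_div_n (exprMn _ Lam) [Num.sqrt M ^+ 2]sqr_sqrtr ?(ltW M0).
    by rewrite mulrA mulrAC.
  have c0 : 0 <= (e / q.+1%:R) ^+ n.+2 / (Lam ^+ 2 * M).
    apply: divr_ge0; first by rewrite exprn_ge0// divr_ge0// ltW.
    by apply: mulr_ge0 (ltW M0); exact: sqr_ge0.
  apply: le_trans (ler_wpM2l (exprn_ge0 _ c0) (Dmom q)) _.
  rewrite mulrA -exprMn -/M ler_wpM2r//; apply: lerXn2r; rewrite ?nnegrE ?invr_ge0//.
    apply: mulr_ge0 c0 (mulr_ge0 (mulr_ge0 (ltW K0) _) (ltW M0)).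
    exact: exprn_ge0.
  rewrite Lam2 expr_div_n le_eqVlt; apply/orP; left; apply/eqP.
  have : q.+1%:R ^+ n.+2 != 0 :> R by rewrite expf_neq0// pnatr_eq0.
  have : e ^+ n.+2 != 0 by rewrite expf_neq0// gt_eqF.
  move: (q.+1%:R ^+ _) (e ^+ _) => x y y0 x0.
  by field; rewrite x0 y0 !gt_eqF.
apply: le_trans (ler_sum _ (fun (q : 'I_L) _ => term q)) _.
rewrite -mulr_suml ler_wpM2r//.
exact: sum_half_le1.
Qed.

Local Open Scope classical_set_scope.
Local Open Scope ring_scope.

(** * Orlicz norms and averaging *)

Section orlicz.
Context (R : realType) (psi : R -> R).

Lemma orlicz_function_le : orlicz_function psi ->
  forall x y, 0 <= x -> x <= y -> psi x <= psi y.
Proof.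
move=> [_ incr _] x y x0; rewrite le_eqVlt => /predU1P[->//|xy].
by rewrite ltW// incr// nnegrE// (le_trans x0)// ltW.
Qed.

Lemma orlicz_function_ge0 : orlicz_function psi -> forall x, 0 <= x -> 0 <= psi x.
Proof.
by move=> o x x0; rewrite -(orlicz_function0 o); exact: orlicz_function_le.
Qed.

(** Convexity between [x] and 0, where [psi] vanishes. Enlarging the scale by [c] thus divides the
    integral of [psi] by at least [c]. *)
Lemma orlicz_function_scale : orlicz_function psi ->
  forall x c, 0 <= x -> 1 <= c -> psi (x / c) <= psi x / c.
Proof.
move=> [psi0 _ cvx] x c x0 c1.
have c0 : 0 < c by exact: lt_le_trans c1.
have ci : (0 <= c^-1 <= 1) by rewrite invr_ge0 ltW//= invf_le1.
have [c'0 c'1] := andP ci.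
have xD : (x : convex_lmodType R^o) \in (`[0, +oo[%classic : set R).
  by rewrite inE/= in_itv/= x0.
have zD : (0 : convex_lmodType R^o) \in (`[0, +oo[%classic : set R).
  by rewrite inE/= in_itv/= lexx.
have := cvx (Itv01 c'0 c'1) _ _ xD zD.
rewrite psi0.
have -> : conv (Itv01 c'0 c'1) (x : convex_lmodType R^o) (0 : convex_lmodType R^o) =
    c^-1 * x + (1 - c^-1) * 0 by [].
have -> : conv (Itv01 c'0 c'1) (psi x : R^o) (0 : R^o) =
    c^-1 * psi x + (1 - c^-1) * 0 by [].
by rewrite !mulr0 !addr0 mulrC (mulrC _ (psi x)).
Qed.

Lemma exp_orlicz_function_le (alpha : R) : exp_orlicz_function alpha psi ->
  exists2 c : R, 0 <= c & forall x, 0 <= x -> psi x <= c + expR (x `^ alpha).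
Proof.
move=> [ho [M [_ hM]]].
have M1 : 0 <= Num.max M 0 + 1 by rewrite addr_ge0// le_max lexx orbT.
(* Below a nonnegative threshold beyond [M], where the exponential formula may fail, monotonicity
   bounds [psi] by its value at the threshold. *)
exists (psi (Num.max M 0 + 1)); first exact: orlicz_function_ge0.
move=> x x0; have [xM|Mx] := leP x (Num.max M 0 + 1).
  by rewrite (le_trans (orlicz_function_le ho x0 xM))// lerDl expR_ge0.
rewrite hM; last by rewrite (le_lt_trans _ Mx)// ler_wpDr// le_max lexx.
by rewrite addrC lerD2r (le_trans _ (orlicz_function_ge0 ho M1))// lerN10.
Qed.

Lemma orlicz_norm_le (n : nat) (f : euclid R n -> R) K : 0 < K ->
  (\int[lebesgueE R n]_(x in unit_cube R n) (psi (`|f x| / K))%:E <= 1)%E ->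
  (orlicz_norm psi f <= K%:E)%E.
Proof. by move=> K0 hf; apply: ereal_inf_lbound; exists K. Qed.

(** [psi] is monotone only on the nonnegative half-line; composing with [Num.max 0] makes it
    monotone on all of [R], hence Borel. *)
Lemma measurable_orlicz_comp d (T : measurableType d) (f : T -> R) (D : set T) :
  orlicz_function psi -> measurable_fun D f -> (forall x, 0 <= f x) ->
  measurable_fun D (fun x => psi (f x)).
Proof.
move=> o mf f0.
have -> : (fun x => psi (f x)) = (fun y => psi (Num.max 0 y)) \o f.
  by apply/funext => x /=; congr psi; apply/esym/max_idPr.
apply: measurableT_comp mf; apply: nondecreasing_measurable => // x y xy.
apply: orlicz_function_le => //; first by rewrite le_max lexx.
by rewrite ge_max !le_max lexx xy orbT.
Qed.

End orlicz.

Section cube.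
Context (R : realType) (n : nat).

Let unit_cubeE : unit_cube R n = [set x | forall i, [set` `[0 : R, 1]] (tnth x i)].
Proof. by apply/seteqP; split => y Hy i; have := Hy i; rewrite /= in_itv. Qed.

Lemma measurable_tnth_forall (A : 'I_n -> set (measurableTypeR R)) :
  (forall i, measurable (A i)) ->
  measurable [set x : euclid R n | forall i, A i (tnth x i)].
Proof.
move=> mA.
rewrite (_ : [set _ | _] = \big[setI/setT]_(i < n)
    ((fun x : euclid R n => tnth x i) @^-1` A i)).
  apply: bigsetI_measurable => i _; rewrite -[X in measurable X]setTI.
  exact: measurable_tnth.
rewrite -bigcap_seq; apply/seteqP; split => [x Bx i _|x + i]; first exact: Bx.
by apply; rewrite /= mem_index_enum.
Qed.

Lemma measurable_unit_cube : measurable (unit_cube R n).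
Proof.
rewrite unit_cubeE; apply: (measurable_tnth_forall (A := fun=> [set` `[0 : R, 1]])) => i.
exact: measurable_itv.
Qed.

Lemma lebesgueE_unit_cube : lebesgueE R n (unit_cube R n) = 1%E.
Proof.
rewrite unit_cubeE (lebesgueE_prod (A := fun=> [set` `[0 : R, 1]])).
  by rewrite big1// => i _; rewrite lebesgue_measure_itv/= lte_fin ltr01 sube0.
by move=> i; exact: measurable_itv.
Qed.

Lemma card_fset_filter (T : choiceType) (P : {fset T}) (Q : pred T) :
  #|` [fset p in P | Q p]%fset| = (\sum_(p <- P) Q p)%N.
Proof.
rewrite card_fset_sum1 big_fset/=.
by rewrite big_mkcond; apply: eq_bigr => p _; case: (Q p).
Qed.

Lemma measurable_discrepancy (P : {fset euclid R n}) D :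
  measurable_fun D (discrepancy P).
Proof.
apply: measurable_funB; last first.
  apply: measurable_funM => //; apply: measurable_prod => i _.
  by apply: measurable_funTS; exact: (measurable_tnth i).
under eq_fun do rewrite card_fset_filter natr_sum.
apply: measurable_sum => p.
(* As a function of the corner, membership of [p] is the indicator of a product of rays, empty when
   [p] has a negative coordinate. *)
rewrite (_ : (fun _ => _) = \1_[set x : euclid R n |
    forall i, [set y : R | 0 <= (tnth p i : R) <= y] (tnth x i)]).
  apply: measurable_indic.
  apply: (measurable_tnth_forall (A := fun i => [set y : R | 0 <= (tnth p i : R) <= y])) => i.
  have [p0|p0] := boolP (0 <= (tnth p i : R)).
    rewrite (_ : [set _ | _] = [set` `[(tnth p i : R), +oo[]); first exact: measurable_itv.
    by apply/seteqP; split => y /=; rewrite in_itv/= andbT.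
  by rewrite (_ : [set _ | _] = set0)//; apply/seteqP; split.
by apply/funext => x; rewrite indicE.
Qed.

End cube.

Lemma exists_integral_le1 d (T : measurableType d) (R : realType)
    (mu : {measure set T -> \bar R}) (D : set T) (I : finType) (f : I -> T -> R) :
  measurable D -> mu D = 1%E -> (0 < #|I|)%N ->
  (forall i, measurable_fun D (f i)) -> (forall i x, D x -> 0 <= f i x) ->
  (forall x, D x -> \sum_i f i x <= #|I|%:R) ->
  exists i, (\int[mu]_(x in D) (f i x)%:E <= 1)%E.
Proof.
move=> mD muD I0 mf f0 fI; apply: contrapT => /forallNP no.
have {}no i : (1 < \int[mu]_(x in D) (f i x)%:E)%E by rewrite ltNge; exact/negP.
have sumI : (\sum_i \int[mu]_(x in D) (f i x)%:E <= #|I|%:R%:E)%E.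
  have mfE i : measurable_fun D (fun x => (f i x)%:E) by exact/measurable_EFinP.
  have f0E i x : D x -> (0 <= (f i x)%:E)%E by move=> Dx; rewrite lee_fin f0.
  rewrite -(ge0_integral_sum mu mD mfE f0E).
  apply: (@le_trans _ _ (\int[mu]_(x in D) (cst #|I|%:R%:E) x)%E).
    apply: ge0_le_integral => //.
    - by move=> x Dx; apply: sume_ge0 => i _; rewrite lee_fin f0.
    - by apply: emeasurable_sum => i; exact/measurable_EFinP.
    - by move=> x Dx; rewrite sumEFin lee_fin fI.
  by rewrite integral_cst// muD mule1.
(* An integral may be infinite; real lower bounds above 1 bring the strict comparison of sums back
   to [R]. *)
have ex i : exists r : R, 1 < r /\ (r%:E <= \int[mu]_(x in D) (f i x)%:E)%E.
  move: (no i); case: (\int[mu]_(x in D) (f i x)%:E)%E => [s| |]//.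
    by rewrite lte_fin; exists s.
  by exists 2; rewrite leey ltr1n.
have [r hr] := choice ex.
have : (\sum_i (r i)%:E <= #|I|%:R%:E)%E.
  by apply: le_trans sumI; apply: lee_sum => i _; have [] := hr i.
rewrite sumEFin lee_fin leNgt => /negP; apply.
rewrite -sum1_card natr_sum; apply: ltr_sum => [|i _]; last by have [] := hr i.
by have /card_gt0P[i _] := I0; apply/hasP; exists i; rewrite ?mem_index_enum.
Qed.

(** * The point sets *)

Lemma prod_dist_le (R : realFieldType) (I : Type) (s : seq I) (y z : I -> R) :
  (forall i, 0 <= y i <= 1) -> (forall i, 0 <= z i <= 1) ->
  `|\prod_(i <- s) y i - \prod_(i <- s) z i| <= \sum_(i <- s) `|y i - z i|.
Proof.
move=> y01 z01; elim: s => [|i s IHs]; first by rewrite !big_nil subrr normr0.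
rewrite !big_cons.
rewrite (_ : _ - _ = (y i - z i) * \prod_(j <- s) y j +
  z i * (\prod_(j <- s) y j - \prod_(j <- s) z j)); last by ring.
apply: le_trans (ler_normD _ _) _; apply: lerD.
  rewrite normrM ler_piMr// ger0_norm.
    by apply: prodr_ile1 => j _; exact: y01.
  by apply: prodr_ge0 => j _; have /andP[] := y01 j.
have /andP[z0 z1] := z01 i.
by rewrite normrM ger0_norm//; apply: le_trans IHs; rewrite ler_piMl.
Qed.

Lemma bits_corner (R : realType) (m D : nat) (x : R) :
  (0 < D <= 2 ^ m)%N -> 0 <= x <= 1 -> exists a : nat -> bool,
  [/\ forall v, (v < D)%N -> (v%:R / D%:R <= x) = (v <= bits_num m a)%N,
      (bits_num m a < D)%N &
      `|D%:R * x - (bits_num m a).+1%:R| <= 1].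
Proof.
move=> /andP[D0 Dm] /andP[x0 x1].
(* The cap matters only at [x = 1], where the integer part is [D], outside the range of the
   numerators. *)
pose A := minn (Num.truncn (D%:R * x)) D.-1.
have Dx0 : 0 <= D%:R * x by rewrite mulr_ge0.
have AD : (A < D)%N by rewrite /A; lia.
have [a aA] := bits_num_surj (leq_trans AD Dm).
exists a; rewrite aA; split=> // [v vD|].
  rewrite ler_pdivrMr ?ltr0n// mulrC -truncn_ge_nat// /A leq_min.
  by rewrite (_ : (v <= D.-1)%N) ?andbT//; lia.
have /andP[t1 t2] := truncn_itv Dx0.
have [tD|Dt] := ltnP (Num.truncn (D%:R * x)) D.
  have -> : A = Num.truncn (D%:R * x) by rewrite /A; lia.
  move: t1 t2; rewrite ler_norml -(natr1 (Num.truncn _)).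
  by move: ((Num.truncn (D%:R * x))%:R : R) (D%:R * x) => u w; lra.
have -> : A.+1 = D by rewrite /A; lia.
have Dx : D%:R * x = D%:R.
  apply/le_anti; rewrite ler_piMr//=; apply: le_trans t1.
  by rewrite ler_nat.
by rewrite Dx subrr normr0.
Qed.

Lemma prodr_bool (R : comPzRingType) (I : finType) (b : pred I) :
  \prod_i (b i)%:R = [forall i, b i]%:R :> R.
Proof.
have [/forallP h|] := boolP [forall i, b i]; first by rewrite big1// => i _; rewrite h.
by rewrite negb_forall => /existsP[i /negPf bi]; rewrite (bigD1 i)//= bi mul0r.
Qed.

Section net_points.
Context (R : realType) (n m N : nat).
Variable B : 'rV['F_2]_m.+1 -> nat -> nat -> bool.
Hypothesis B_inj : forall p p', (forall i, (i < m.+1)%N -> B p 0 i = B p' 0 i) -> p = p'.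
Hypothesis N_bounds : (0 < N <= 2 ^ m.+1)%N.

Local Notation net_num T p j := (bits_num m.+1 (shifted (n := n) B T p j)).

(** The stretching of the first coordinate: keeping numerators below [N] and dividing by [N] spreads
    the points over the whole unit interval. *)
Definition net_den (j : 'I_n.+1) : nat := if j == ord0 then N else (2 ^ m.+1)%N.

Definition net_point (T : net_shift n m) p : euclid R n.+1 :=
  [tuple ((net_num T p j)%:R / (net_den j)%:R : R) | j < n.+1].

Definition net_points (T : net_shift n m) : {fset euclid R n.+1} :=
  [fset x in [seq net_point T p | p <- enum [pred p | (net_num T p ord0 < N)%N]]]%fset.

Let net_den_bounds j : (0 < net_den j <= 2 ^ m.+1)%N.
Proof. by rewrite /net_den; case: ifP => // _; rewrite expn_gt0 leqnn. Qed.

Let net_num_inj (T : net_shift n m) p p' : net_num T p ord0 = net_num T p' ord0 -> p = p'.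
Proof.
by move=> /bits_num_inj h; apply: B_inj => i /h; rewrite /shifted => /addIb.
Qed.

Let net_point_inj T : injective (net_point T).
Proof.
move=> p p' /(congr1 (fun x => tnth x ord0)); rewrite !tnth_mktuple => h.
apply: (@net_num_inj T); apply/eqP; rewrite -(eqr_nat R); apply/eqP.
apply: (mulIf _ h); rewrite invr_neq0// pnatr_eq0 -lt0n.
by have /andP[] := net_den_bounds ord0.
Qed.

(** The first coordinate takes each of the [2 ^ m.+1] numerators exactly once, by injectivity and
    equality of cardinals. *)
Let card_first (T : net_shift n m) : #|[pred p | (net_num T p ord0 < N)%N]| = N.
Proof.
have /andP[_ Nm] := N_bounds.
pose f p : 'I_(2 ^ m.+1) := Ordinal (bits_num_lt m.+1 (shifted (n := n) B T p ord0)).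
have f_inj : injective f by move=> p p' /(congr1 val)/= /net_num_inj.
have f_bij : bijective f.
  by apply: inj_card_bij => //; rewrite card_ord card_mx card_Fp// mul1n.
rewrite -sum1_card; transitivity (\sum_(i < 2 ^ m.+1 | (i < N)%N) 1)%N.
  by rewrite [RHS](reindex f)//=; exact: onW_bij.
by rewrite (big_ord_narrow Nm) sum1_card card_ord.
Qed.

Lemma card_net_points T : #|` net_points T| = N.
Proof.
rewrite card_fseq undup_id; first by rewrite size_map -cardE card_first.
by rewrite map_inj_uniq ?enum_uniq//; exact: net_point_inj.
Qed.

Lemma net_points_cube T p : p \in net_points T -> p \in unit_cube R n.+1.
Proof.
rewrite inE/= => /mapP[q]; rewrite mem_enum inE => qN ->; rewrite inE => j.
rewrite tnth_mktuple divr_ge0//= ler_pdivrMr ?mul1r ?ler_nat ?ltr0n; last first.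
  by have /andP[] := net_den_bounds j.
rewrite /net_den; case: eqVneq => [->|_]; first exact: ltnW.
exact: ltnW (bits_num_lt _ _).
Qed.

(** Rounding [X] to a corner [a] leaves the count unchanged. In the volume term each factor moves by
    at most [2 ^ (- m.+1)], so after multiplication by [2 ^ m.+1] the error is at most the dimension
    [n.+1]. *)
Lemma net_points_discrepancy (X : euclid R n.+1) : unit_cube R n.+1 X ->
  exists a : 'I_n.+1 -> nat -> bool, forall T,
  `|discrepancy (net_points T) X| <= `|net_discrepancy R B a T| + n.+1%:R.
Proof.
move=> X01.
have [a ha] := choice (fun j => bits_corner (net_den_bounds j) (X01 j)).
exists a => T.
have -> : discrepancy (net_points T) X = net_discrepancy R B a T +
  (2 ^+ m.+1 * \prod_j ((bits_num m.+1 (a j)).+1%:R / 2 ^+ m.+1) -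
   2 ^+ m.+1 * \prod_j ((net_den j)%:R * (tnth X j : R) / 2 ^+ m.+1)).
  rewrite /discrepancy /net_discrepancy card_net_points addrA subrK; congr (_ - _).
    rewrite card_fset_filter natr_sum.
    pose s := [seq net_point T p | p <- enum [pred p | (net_num T p ord0 < N)%N]].
    have s_uniq : uniq s by rewrite map_inj_uniq ?enum_uniq//; exact: net_point_inj.
    have perm_s : perm_eq (net_points T) s.
      by apply: uniq_perm => // x; rewrite inE.
    rewrite (perm_big _ perm_s)/= big_map big_enum/= big_mkcond/=.
    apply: eq_bigr => p _; rewrite prodr_bool inE.
    case: ifP => pN.
      congr (nat_of_bool _)%:R; apply/idP/forallP => [|h].
        rewrite inE => h j; have [hj _ _] := ha j.
        have := h j; rewrite tnth_mktuple => /andP[_]; rewrite hj//.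
        rewrite /net_den; case: eqVneq => [->//|_]; exact: bits_num_lt.
      rewrite inE => j; rewrite tnth_mktuple divr_ge0//=; have [-> //] := ha j.
      rewrite /net_den; case: eqVneq => [->//|_]; exact: bits_num_lt.
    (* The discarded points lie outside the box of [a], whose first numerator is below [N]. *)
    case: forallP => // /(_ ord0) h; have [_ aN _] := ha ord0.
    by move: pN; rewrite (leq_ltn_trans h aN).
  rewrite /box_volume [in LHS]big_ord_recl [in RHS]big_ord_recl/= /net_den eqxx.
  have P0 : 2 ^+ m.+1 != 0 :> R by rewrite expf_neq0// pnatr_eq0.
  rewrite [in RHS](eq_bigr (fun j : 'I_n => tnth X (lift ord0 j) : R)); last first.
    by move=> j _; rewrite -natrX mulrAC mulfV ?mul1r// natrX.
  rewrite !mulrA; congr (_ * _); move: (2 ^+ m.+1) P0 => y y0.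
  by field.
apply: le_trans (ler_normD _ _) _; rewrite lerD2l -mulrBr normrM ger0_norm ?exprn_ge0//.
have P0 : 0 < 2 ^+ m.+1 :> R by rewrite exprn_gt0.
rewrite mulrC -ler_pdivlMr//.
apply: le_trans (prod_dist_le _ _ _) _.
- move=> j; have [_ aj _] := ha j.
  rewrite divr_ge0 ?exprn_ge0//= ler_pdivrMr// mul1r -natrX ler_nat.
  by rewrite (leq_trans aj)//; have /andP[] := net_den_bounds j.
- move=> j; have /andP[x0 x1] := X01 j; have /andP[_ dj] := net_den_bounds j.
  rewrite divr_ge0 ?mulr_ge0 ?exprn_ge0//= ler_pdivrMr// mul1r.
  apply: (@le_trans _ _ (net_den j)%:R); first by rewrite ler_piMr.
  by rewrite -natrX ler_nat.
- apply: (@le_trans _ _ (\sum_(j < n.+1) (2 ^+ m.+1)^-1)); last first.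
    by rewrite sumr_const card_ord -[_ *+ n.+1]mulr_natl.
  apply: ler_sum => j _; have [_ _ h] := ha j.
  by rewrite -mulrBl normrM distrC ger0_norm ?invr_ge0 ?exprn_ge0// ler_piMl ?invr_ge0 ?exprn_ge0.
Qed.

End net_points.

(** * Passage to the logarithm and conclusion *)

Lemma sqrt_bits_le_ln (R : realType) (n m N : nat) : (2 ^ m < N)%N -> (2 <= N)%N ->
  Num.sqrt (m.+2%:R ^+ n) <=
  Num.sqrt ((3 / ln 2) ^+ n) * ln (N%:R : R) `^ (n%:R / 2%:R).
Proof.
move=> mN N2.
have ln2 : 0 < ln 2 :> R by rewrite ln_gt0// ltr1n.
have lnN : ln 2 <= ln (N%:R : R) by rewrite ler_ln ?posrE ?ltr0n ?ler_nat//; lia.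
have lnN0 : 0 <= ln (N%:R : R) by rewrite (le_trans _ lnN)// ltW.
have mlnN : m%:R * ln 2 <= ln (N%:R : R).
  rewrite mulr_natl -lnXn// -natrX ler_ln ?posrE ?ltr0n ?expn_gt0//; last by lia.
  by rewrite ler_nat ltnW.
(* The 3 collects one [ln N] for [m * ln 2] and two more for [2 * ln 2]. *)
have mle : m.+2%:R <= 3 / ln 2 * ln (N%:R : R).
  rewrite mulrAC ler_pdivlMr// -addn2 natrD mulrDl.
  by move: (ln N%:R) lnN mlnN => y; lra.
rewrite powRrM powR12_sqrt ?powR_ge0// powR_mulrn// -sqrtrM; last first.
  by rewrite exprn_ge0// divr_ge0// ltW.
rewrite ler_sqrt; last by rewrite mulr_ge0 ?exprn_ge0// divr_ge0// ltW.
by rewrite -exprMn; apply: lerXn2r; rewrite ?nnegrE// mulr_ge0// divr_ge0// ltW.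
Qed.

Theorem theorem1p1 (R : realType) (n : nat) (hn : (2 <= n)%N)
    (psi : R -> R) (hpsi : exp_orlicz_function (2%:R / (n%:R + 1)) psi) :
  exists C : R, forall N : nat, (2 <= N)%N ->
    exists P : {fset euclid R n},
      [/\ (forall p, p \in P -> p \in unit_cube R n),
          #|` P| = N
        & (orlicz_norm psi (discrepancy P)
             <= (C * ln (N%:R : R) `^ ((n%:R - 1) / 2%:R))%:E)%E].
Proof.
case: n hn hpsi => [//|n] _; rewrite natr1 => hpsi.
have o := hpsi.1.
have [t ht] := digital_net_exists n.+1.
have [Lam Lam0 hLam] := net_exp_moment R n t.
have [c c0 hc] := exp_orlicz_function_le hpsi.
(* A bound for the average over shifts of [psi] at scale [S], uniform in the corner; enlarging the
   scale to [M * S] brings this average down to 1. *)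
pose M := c + (expR 1 + 1).
have M1 : 1 <= M by rewrite /M; have := expR_ge0 (1 : R); move: c0; lra.
exists (M * Lam * Num.sqrt ((3 / ln 2) ^+ n)) => N N2.
(* The predecessor gives [2 ^ m < N <= 2 ^ m.+1], and the net is taken with [2 ^ m.+1] points. *)
pose m := (up_log 2 N).-1.
have /andP[mN Nm] : (2 ^ m < N <= 2 ^ m.+1)%N.
  rewrite /m; have := up_log_bounds (isT : 1 < 2)%N N2.
  by case: (up_log 2 N) => [/andP[_]|//]; rewrite expn0 leqNgt N2.
have [B [Badd Bsurj Binj]] := ht m.+1.
pose S : R := Lam * Num.sqrt (m.+2%:R ^+ n).
have S0 : 0 < S by rewrite mulr_gt0// sqrtr_gt0 exprn_gt0.
have K0 : 0 < M * S by rewrite mulr_gt0// (lt_le_trans _ M1).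
have N_bounds : (0 < N <= 2 ^ m.+1)%N by rewrite Nm andbT ltnW.
pose P T := net_points R (n := n) N B T.
have [T hT] : exists T : net_shift n m,
    (\int[lebesgueE R n.+1]_(x in unit_cube R n.+1)
      (psi (`|discrepancy (P T) x| / (M * S)))%:E <= 1)%E.
  apply: exists_integral_le1.
  - exact: measurable_unit_cube.
  - exact: lebesgueE_unit_cube.
  - by apply/card_gt0P; exists [ffun=> false].
  - move=> T; apply: measurable_orlicz_comp => //.
      apply: measurable_funM => //; apply: measurableT_comp => //.
      exact: measurable_discrepancy.
    by move=> x; rewrite divr_ge0// ltW.
  - by move=> T x _; rewrite orlicz_function_ge0// divr_ge0// ltW.
  move=> X X01.
  have [a ha] := net_points_discrepancy Binj N_bounds X01.
  have ptw T : psi (`|discrepancy (P T) X| / (M * S)) <= (c +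
      expR (((`|net_discrepancy R B a T| + n.+1%:R) / S) `^ (2 / n.+2%:R))) / M.
    rewrite invfM mulrCA mulrC.
    have Z0 : 0 <= `|discrepancy (P T) X| / S by rewrite divr_ge0// ltW.
    apply: le_trans (orlicz_function_scale o Z0 M1) _.
    rewrite ler_wpM2r ?invr_ge0 ?(le_trans ler01 M1)//.
    apply: le_trans (hc _ _); last by rewrite divr_ge0 ?addr_ge0// ltW.
    by apply: orlicz_function_le => //; rewrite ler_wpM2r ?invr_ge0 ?(ltW S0).
  apply: le_trans (ler_sum _ (fun T _ => ptw T)) _.
  rewrite -mulr_suml ler_pdivrMr ?(lt_le_trans ltr01 M1)// big_split/=.
  rewrite sumr_const -[_ *+ #|_|]mulr_natl /M mulrDr lerD2l [leRHS]mulrC.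
  exact: hLam.
exists (P T); split.
- by move=> p; exact: net_points_cube.
- exact: card_net_points.
apply: le_trans (orlicz_norm_le K0 hT) _.
rewrite lee_fin /S -!mulrA ler_wpM2l ?(le_trans ler01 M1)// ler_wpM2l ?(ltW Lam0)//.
rewrite (_ : n.+1%:R - 1 = n%:R); last by rewrite -natr1 addrK.
exact: sqrt_bits_le_ln.
Qed.
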